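(* Let $G$ be a locally compact abelian group with a countable basis of its topology and let $\mathcal N=(N,\Omega,m,T)$ be a full spatial process over $G$. If $N(\varphi)\ge 0$ holds for all $\varphi\in C_c(G)$ with $\varphi\ge 0$, then $\mathcal N$ is equivalent to (the spatial process of) a positive measure dynamical system (PMDS).
   Context: Notation: $G$ is written additively. $C_c(G)$ is the space of continuous compactly supported functions $G\to\mathbb C$, with the locally convex inductive limit topology of the spaces $C_c(K)$ (continuous functions on $G$ with support in the compact set $K\subset G$, sup norm). $\tau_t\varphi=\varphi(\cdot-t)$ for $t\in G$. $N(\varphi)\ge0$ is meant in $L^2(\Omega,m)$, i.e. $m$-almost everywhere. Dynamical systems: a dynamical system $(X,\alpha)$ over $G$ is either topological ($X$ compact Hausdorff and $\alpha:G\times X\to X$ a continuous action) or measurable ($X$ a measurable space and $\alpha$ an action of $G$ on $X$ that is measurable in each variable). If $m$ is a $G$-invariant probability measure on $X$, the Koopman representation $T$ of $G$ on $L^2(X,m)$ is $T_tf=f\circ\alpha_{-t}$. Spatial process: $\mathcal N=(N,X,m,T)$ consists of a dynamical system $(X,\alpha)$ over $G$, a $G$-invariant probability measure $m$ on $X$, with Koopman representation $T$, and a linear continuous map $N:C_c(G)\to L^2(X,m)$ with $\overline{N(\varphi)}=N(\overline\varphi)$ for all $\varphi\in C_c(G)$ and $T_t\circ N=N\circ\tau_t$ for all $t\in G$. It is full if the linear span of all products $\vartheta_1(N(\varphi_1))\cdots\vartheta_n(N(\varphi_n))$, $n\in\mathbb N$, $\vartheta_j\in C_c(\mathbb C)$,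 $\varphi_j\in C_c(G)$, is dense in $L^2(X,m)$. Equivalence: spatial processes $(N,X,m,T)$ and $(N',X',m',T')$ are equivalent (spatially isomorphic) if there is a unitary $U:L^2(X,m)\to L^2(X',m')$ with $U\circ N=N'$, $U\circ T_t=T'_t\circ U$ for all $t\in G$, $U(fg)=U(f)U(g)$ for all $f,g\in L^\infty(X,m)$ and $U^{-1}(f'g')=U^{-1}(f')U^{-1}(g')$ for all $f',g'\in L^\infty(X',m')$. PMDS: $\mathcal M(G)$ is the dual of $C_c(G)$ (complex measures on $G$ in the sense of Riesz–Markov), with the vague (weak-$*$) topology and its Borel $\sigma$-algebra, and $G$ acts on it by $\alpha_t(\nu)(\varphi)=\nu(\tau_{-t}\varphi)$. $\mathcal M^+(G)$ is the ($\alpha$-invariant) set of $\nu\in\mathcal M(G)$ with $\nu(\varphi)\ge0$ for all $\varphi\in C_c(G)$, $\varphi\ge0$, with the restricted $\sigma$-algebra. For $\varphi\in C_c(G)$ let $N'(\varphi)(\omega)=\omega(\varphi)=\int_G\varphi\,d\omega$, $\omega\in\mathcal M^+(G)$. A PMDS is $(\mathcal M^+(G),\alpha)$ together with an $\alpha$-invariant probability measure $m'$ on $\mathcal M^+(G)$ that is square integrable, i.e. $\int_{\mathcal M^+(G)}|N'(\varphi)|^2\,dm'<\infty$ for all $\varphi\in C_c(G)$; its spatial process is $(N',\mathcal M^+(G),m',T')$ with $T'$ the Koopman representation. *)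

(* Defs.v *)
From HB Require Import structures.
From mathcomp Require Import all_boot all_order all_algebra.
From mathcomp Require Import all_classical all_reals all_analysis.
From mathcomp.real_closed Require Import complex.

Set Implicit Arguments.
Unset Strict Implicit.
Unset Printing Implicit Defensive.

Import Order.TTheory GRing.Theory Num.Theory.
Import numFieldNormedType.Exports.

Local Open Scope classical_set_scope.
Local Open Scope complex_scope.
Local Open Scope ring_scope.

(* Complex-valued functions take values in R[i]^o, which, unlike R[i], carries
   the norm topology. *)

Notation Borel T := (g_sigma_algebraType (@open T)).

Import ComplexField.Normc.

Definition cconj (R : realType) (z : R[i]^o) : R[i]^o := conjc (z : R[i]).

Lemma normcEC (R : realType) (z : R[i]) : `|z| = (normc z)%:C.
Proof. by case: z => a b; rewrite normc_def. Qed.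

Lemma normc_double (R : realType) (z : R[i]) : normc (z *+ 2) = normc z *+ 2.
Proof. by apply: complexI; rewrite -normcEC normrMn normcEC rmorphMn. Qed.

Lemma half_double (K : numFieldType) (V : lmodType K) (v : V) :
  2^-1 *: (v *+ 2) = v.
Proof. by rewrite -[v *+ 2]scaler_nat scalerA mulVf ?pnatr_eq0// scale1r. Qed.

Lemma cconj_continuous (R : realType) : continuous (@cconj R).
Proof.
move=> z; apply/(@cvgrPdist_lt _ _ _ _ (nbhs_filter z)) => e e0.
have /(@cvgrPdist_lt _ _ _ _ (nbhs_filter z))/(_ _ e0) : (id : R[i]^o -> R[i]^o) @ z --> z by exact: cvg_id.
apply: filterS => t; have -> : cconj z - cconj t = cconj (z - t).
  by rewrite /cconj raddfB.
by move=> zt; rewrite -[ltLHS]/(`|((z - t : R[i])^*)%C|) normcJ.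
Qed.

Section Cc_def.
Variables (T : topologicalType) (R : realType).
Local Notation C := (R[i]^o).

Definition tsupp (f : T -> C) : set T := closure [set x | f x != 0].

Definition Cc_pred : {pred T -> C} :=
  [pred f : T -> C | `[< continuous f /\ compact (tsupp f) >]].

Lemma Cc_predP (f : T -> C) :
  (f \in Cc_pred) <-> continuous f /\ compact (tsupp f).
Proof. by split=> [/asboolP|h] //; exact: asboolT. Qed.

Lemma tsupp0 : tsupp (0 : T -> C) = set0.
Proof.
rewrite /tsupp -closure0; congr closure.
by rewrite -subset0 => x /=; rewrite eqxx.
Qed.

Lemma Cc_submod_closed : submod_closed Cc_pred.
Proof.
split.
  apply/Cc_predP; split; first by move=> x; exact: cvg_cst.
  by rewrite tsupp0; exact: compact0.
move=> a f g /Cc_predP [cf kf] /Cc_predP [cg kg]; apply/Cc_predP; split.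
  move=> x; apply: (@cvgD _ _ _ _ (nbhs_filter x)); last exact: cg.
  by apply: (@cvgZl_tmp _ _ _ _ (nbhs_filter x)); exact: cf.
apply: (subclosed_compact (@closed_closure _ _) (compactU kf kg)).
rewrite /tsupp -closureU; apply: closureS => x /= h.
have [fx0|] := eqVneq (f x) 0; last by left.
right; apply: contra_neq h => gx0.
by rewrite -[LHS]/(a *: f x + g x) fx0 gx0 scaler0 addr0.
Qed.

HB.instance Definition _ :=
  GRing.isSubmodClosed.Build R[i] (T -> C) Cc_pred Cc_submod_closed.

Record Cc := MkCc { Cc_fun :> T -> C ; Cc_funP : Cc_fun \in Cc_pred }.

HB.instance Definition _ := [isSub for Cc_fun].
HB.instance Definition _ := [Choice of Cc by <:].
HB.instance Definition _ := [SubChoice_isSubLmodule of Cc by <:].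

End Cc_def.

Section inductive_limit_topology.
Variables (T : topologicalType) (R : realType).
Implicit Types (phi psi : Cc T R) (W : set (Cc T R)).

Definition absolutely_convex W :=
  forall (a b : R[i]) phi psi, `|a| + `|b| <= 1 ->
    W phi -> W psi -> W (a *: phi + b *: psi).

(* The absolutely convex sets whose trace on every C_c(K) is a neighborhood of
   0 for the sup norm are a base of neighborhoods of 0 for the finest locally
   convex topology that makes all the inclusions of the C_c(K) continuous. *)
Definition ind_base0 W :=
  absolutely_convex W /\
  forall K : set T, compact K -> exists2 e : R, 0 < e &
    forall phi, tsupp phi `<=` K -> (forall x, normc (phi x) <= e) -> W phi.

Definition ind_nbhs phi : set_system (Cc T R) :=
  [set V | exists2 W, ind_base0 W & forall psi, W (psi - phi) -> V psi].

HB.instance Definition _ := isPointed.Build (Cc T R) 0.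
HB.instance Definition _ := hasNbhs.Build (Cc T R) ind_nbhs.

Lemma ind_base00 W : ind_base0 W -> W 0.
Proof.
move=> [_ /(_ set0 (@compact0 _)) [e e0]]; apply.
  by move=> x; rewrite tsupp0.
by move=> x; rewrite normc0 ltW.
Qed.

Let ind_nbhs_filter phi : ProperFilter (nbhs phi).
Proof.
split; last first.
  split.
  - exists setT => //; split => // K _; exists 1 => //.
  - move=> P Q [U [aU bU] UP] [V [aV bV] VQ].
    exists (U `&` V) => [|psi [/UP ? /VQ ?]//].
    split=> [a b f g ab [Uf Vf] [Ug Vg]|K cK]; first by split; [exact: aU|exact: aV].
    have [d d0 dU] := bU K cK; have [e e0 eV] := bV K cK.
    exists (Num.min d e) => [|f fK fde]; first by rewrite lt_min d0.
    by split; [apply: dU|apply: eV] => // x;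
      have := fde x; rewrite le_min => /andP[].
  - by move=> P Q PQ [W bW WP]; exists W => // psi /WP /PQ.
by move=> [W bW] /(_ phi); apply; rewrite subrr; exact: ind_base00.
Qed.

Let ind_nbhs_singleton phi (A : set (Cc T R)) : nbhs phi A -> A phi.
Proof. by move=> [W bW]; apply; rewrite subrr; exact: ind_base00. Qed.

Let ind_nbhs_nbhs phi (A : set (Cc T R)) :
  nbhs phi A -> nbhs phi (nbhs^~ A).
Proof.
move=> [W [aW bW] WA]; pose V := [set f : Cc T R | W (f *+ 2)].
have bV : ind_base0 V.
  split=> [a b f g ab Vf Vg|K cK].
    by rewrite /V /= mulrnDl !scalerMnr; exact: aW.
  have [e e0 eW] := bW K cK; exists (e / 2%:R) => [|f fK fe].
    by rewrite divr_gt0.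
  apply: eW => [|x].
    apply: subset_trans fK; apply: closureS => x /=.
    by apply: contra_neq => fx0; rewrite -[LHS]/(f x *+ 2) fx0 mul0rn.
  rewrite -[X in normc X]/((f x *+ 2 : R[i]^o)) normc_double.
  by have := fe x; rewrite ler_pdivlMr// mulr_natr.
exists V => // psi Vpsi; exists V => // chi Vchi; apply: WA.
rewrite (_ : chi - phi =
  2^-1 *: ((psi - phi) *+ 2) + 2^-1 *: ((chi - psi) *+ 2)).
  by apply: aW => //; rewrite ger0_norm ?invr_ge0 ?ler0n// -[2^-1]mul1r -splitr.
by rewrite !half_double [RHS]addrC subrKA.
Qed.

HB.instance Definition _ := Nbhs_isNbhsTopological.Build (Cc T R)
  ind_nbhs_filter ind_nbhs_singleton ind_nbhs_nbhs.

End inductive_limit_topology.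

Section translation.
Variables (G : topologicalZmodType) (R : realType).
Local Notation C := (R[i]^o).
Implicit Types (t : G) (phi psi : Cc G R).

Lemma addr_continuousr t : continuous (fun x : G => x + t).
Proof.
move=> x; apply: (@continuous_comp _ _ _ (fun x : G => (x, t))
  (fun x : G * G => x.1 + x.2)); last exact: add_continuous.
by apply: cvg_pair => /=; [exact: cvg_id|exact: cvg_cst].
Qed.

Lemma tsupp_translate (f : G -> C) t :
  tsupp (fun x => f (x - t)) `<=` (fun x => x + t) @` tsupp f.
Proof.
move=> x fx; exists (x - t); last by rewrite subrK.
move=> B /(@addr_continuousr (- t) x)/fx [y [/= fy By]].
by exists (y - t).
Qed.

Lemma Cc_translate_subproof t phi : (fun x => phi (x - t)) \in @Cc_pred G R.
Proof.
have /Cc_predP [cphi kphi] := Cc_funP phi; apply/Cc_predP; split.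
  move=> x; apply: (@continuous_comp _ _ _ (fun x : G => x - t) phi).
    exact: addr_continuousr.
  exact: cphi.
apply: (subclosed_compact (@closed_closure _ _) _ (@tsupp_translate _ _)).
apply: continuous_compact kphi; apply: continuous_subspaceT => x.
exact: addr_continuousr.
Qed.

Definition Cc_translate t phi : Cc G R := MkCc (Cc_translate_subproof t phi).

Lemma Cc_conj_subproof phi : (fun x => cconj (phi x)) \in @Cc_pred G R.
Proof.
have /Cc_predP [cphi kphi] := Cc_funP phi; apply/Cc_predP; split.
  by move=> x; apply: continuous_comp; [exact: cphi|exact: cconj_continuous].
apply: (subclosed_compact (@closed_closure _ _) kphi).
apply: closureS => x /=; apply: contra_neq => ->.
by rewrite /cconj raddf0.
Qed.

Definition Cc_conj phi : Cc G R := MkCc (Cc_conj_subproof phi).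

Lemma Cc_translate_linear t : linear (Cc_translate t).
Proof. by move=> a f g; apply/val_inj. Qed.

Lemma Cc_translate_continuous t : continuous (Cc_translate t).
Proof.
move=> phi A [W [aW bW] WA]; exists (Cc_translate t @^-1` W); last first.
  by move=> psi /= Wpsi; apply: WA; rewrite -[X in W X](_ : Cc_translate t (psi - phi) = _)
    //; apply/val_inj.
split=> [a b f g ab /= Wf Wg|K cK].
  by rewrite /preimage /= [Cc_translate _ _](_ : _ = a *: Cc_translate t f + b *: Cc_translate t g);
    [exact: aW|apply/val_inj].
have cK' : compact ((fun x => x + t) @` K).
  by apply: continuous_compact cK; apply: continuous_subspaceT => x;
    exact: addr_continuousr.
have [e e0 eW] := bW _ cK'; exists e => // f fK fe; apply: eW.
  by move=> x /tsupp_translate [y /fK Ky <-]; exists y.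
by move=> x; exact: fe.
Qed.

End translation.

Section measures.
Variables (G : topologicalZmodType) (R : realType).
Local Notation C := (R[i]^o).

(* The dual of C_c(G), as a subspace of C^{C_c(G)} with the topology of
   pointwise convergence: the subspace topology is the vague one. *)
Definition cmeasure : Type :=
  set_type ([set nu | linear (nu : Cc G R -> C) /\ continuous (nu : Cc G R -> C)]
            : set {ptws Cc G R -> C}).

HB.instance Definition _ := Topological.on cmeasure.

Definition cmeasure_fun (nu : cmeasure) : Cc G R -> C := set_val nu.
Coercion cmeasure_fun : cmeasure >-> Funclass.

Lemma cmeasureP (nu : cmeasure) : linear nu /\ continuous nu.
Proof. by have /set_mem := valP nu. Qed.

Definition MkCmeasure (nu : Cc G R -> C) (nuP : linear nu /\ continuous nu) :
  cmeasure := exist _ (nu : {ptws Cc G R -> C}) (mem_set nuP).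

Lemma cmeasure0_subproof :
  linear (fun _ : Cc G R => 0 : C) /\ continuous (fun _ : Cc G R => 0 : C).
Proof.
by split=> [a f g|]; [rewrite scaler0 addr0|exact: cst_continuous].
Qed.

HB.instance Definition _ := isPointed.Build cmeasure
  (MkCmeasure cmeasure0_subproof).

Lemma act_subproof (t : G) (nu : cmeasure) :
  linear (fun phi => nu (Cc_translate (- t) phi)) /\
  continuous (fun phi => nu (Cc_translate (- t) phi)).
Proof.
have [lnu cnu] := cmeasureP nu; split=> [a f g|phi].
  by rewrite Cc_translate_linear lnu.
by apply: continuous_comp; [exact: Cc_translate_continuous|exact: cnu].
Qed.

Definition cmeasure_act (t : G) (nu : cmeasure) : cmeasure :=
  MkCmeasure (act_subproof t nu).

Definition positive_functional : set cmeasure :=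
  [set nu | forall phi : Cc G R, (forall x, 0 <= phi x) -> 0 <= nu phi].

Definition pmeasure_set : Type := set_type positive_functional.

Lemma positive0 : positive_functional point.
Proof. by []. Qed.

HB.instance Definition _ := Choice.on pmeasure_set.
HB.instance Definition _ := isPointed.Build pmeasure_set
  (exist _ (point : cmeasure) (mem_set positive0)).

Definition cmeasure_of_pmeasure (nu : pmeasure_set) : Borel cmeasure :=
  set_val nu.

(* The trace on the positive measures of the vague Borel sigma-algebra. *)
Definition pmeasure := g_sigma_algebra_preimageType cmeasure_of_pmeasure.

Lemma pmeasure_act_subproof (t : G) (nu : pmeasure) :
  positive_functional (cmeasure_act t (set_val (nu : pmeasure_set))).
Proof.
move=> phi phi0; have /set_mem := valP (nu : pmeasure_set); apply => x.
exact: phi0.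
Qed.

Definition pmeasure_act (t : G) (nu : pmeasure) : pmeasure :=
  exist _ (cmeasure_act t (set_val (nu : pmeasure_set)))
    (mem_set (pmeasure_act_subproof t nu)).

Definition pmeasure_eval (phi : Cc G R) (nu : pmeasure) : C :=
  (set_val (nu : pmeasure_set) : cmeasure) phi.

End measures.

(* Elements of L^p are represented by functions; equality in L^p is equality
   almost everywhere. *)
Section Lp.
Context d (X : measurableType d) (R : realType) (m : probability X R).
Local Notation C := (R[i]^o).
Implicit Types f g : X -> C.

Definition Lp_norm (p : \bar R) f : \bar R :=
  Lnorm m p (fun x => (normc (f x))%:E).

Definition Lp (p : \bar R) : set (X -> C) :=
  [set f | measurable_fun [set: X] (f : X -> Borel C) /\ (Lp_norm p f < +oo)%E].

Definition Cintegral f : C :=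
  (\int[m]_x complex.Re (f x)) +i* (\int[m]_x complex.Im (f x)).

Definition L2_dot f g : C := Cintegral (fun x => f x * cconj (g x)).

End Lp.

Section unitary.
Context d d' (X : measurableType d) (X' : measurableType d') (R : realType).
Variables (m : probability X R) (m' : probability X' R).
Local Notation C := (R[i]^o).

(* U is only specified on square integrable functions, up to equality almost
   everywhere. *)
Record L2_isometry (U : (X -> C) -> (X' -> C)) : Prop := {
  isometry_Lp : forall f, Lp m 2%:E f -> Lp m' 2%:E (U f) ;
  isometry_ae : forall f g, Lp m 2%:E f -> Lp m 2%:E g ->
    f = g %[ae m] -> U f = U g %[ae m'] ;
  isometry_linear : forall (a : R[i]) f g, Lp m 2%:E f -> Lp m 2%:E g ->
    U (a *: f + g) = a *: U f + U g %[ae m'] ;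
  isometry_dot : forall f g, Lp m 2%:E f -> Lp m 2%:E g ->
    L2_dot m' (U f) (U g) = L2_dot m f g }.

Definition multiplicative_on_Linf (U : (X -> C) -> (X' -> C)) : Prop :=
  forall f g, Lp m +oo%E f -> Lp m +oo%E g ->
    U (fun x => f x * g x) = (fun x => U f x * U g x) %[ae m'].

End unitary.

Definition L2_unitary d d' (X : measurableType d) (X' : measurableType d')
    (R : realType) (m : probability X R) (m' : probability X' R)
    (U : (X -> R[i]^o) -> (X' -> R[i]^o)) (V : (X' -> R[i]^o) -> (X -> R[i]^o)) :=
  [/\ L2_isometry m m' U, L2_isometry m' m V,
    forall f, Lp m 2%:E f -> V (U f) = f %[ae m] &
    forall g, Lp m' 2%:E g -> U (V g) = g %[ae m']].

Section dynamical_systems.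
Context (G : topologicalZmodType) d (X : measurableType d).
Implicit Type alpha : G -> X -> X.

Definition group_action alpha :=
  (forall x, alpha 0 x = x) /\
  (forall s t x, alpha (s + t) x = alpha s (alpha t x)).

(* The quantified topology is required to generate the given sigma-algebra, so
   that invariant measures in the topological case are Borel measures. *)
Definition topological_ds alpha :=
  group_action alpha /\
  exists cX : Topological.axioms_ X, let Y : topologicalType := Topological.Pack cX in
    [/\ compact [set: Y], hausdorff_space Y,
      (measurable : set (set X)) = <<s @open Y >> &
      continuous (fun p : G * Y => alpha p.1 p.2 : Y)].

Definition measurable_ds alpha :=
  [/\ group_action alpha,
    forall t, measurable_fun [set: X] (alpha t) &
    forall x (A : set X), measurable A -> <<s @open G >> (alpha ^~ x @^-1` A)].

Definition dynamical_system alpha := topological_ds alpha \/ measurable_ds alpha.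

Definition invariant_measure (R : realType) alpha (m : probability X R) :=
  forall t (A : set X), measurable A -> m (alpha t @^-1` A) = m A.

Definition koopman (R : realType) alpha (t : G) (f : X -> R[i]^o) : X -> R[i]^o :=
  fun x => f (alpha (- t) x).

End dynamical_systems.

Section spatial_processes.
Context (R : realType) (G : topologicalZmodType).
Local Notation C := (R[i]^o).

Record spatial_process d (X : measurableType d) (alpha : G -> X -> X)
    (m : probability X R) (N : Cc G R -> X -> C) : Prop := {
  sp_ds : dynamical_system alpha ;
  sp_invariant : invariant_measure alpha m ;
  sp_L2 : forall phi, Lp m 2%:E (N phi) ;
  sp_linear : forall (a : R[i]) phi psi,
    N (a *: phi + psi) = a *: N phi + N psi %[ae m] ;
  sp_continuous : forall phi (e : R), 0 < e ->
    \forall psi \near phi, (Lp_norm m 2%:E (N psi - N phi)%R < e%:E)%E ;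
  sp_conj : forall phi, (fun x => cconj (N phi x)) = N (Cc_conj phi) %[ae m] ;
  sp_equivariant : forall t phi,
    koopman alpha t (N phi) = N (Cc_translate t phi) %[ae m] }.

Section full.
Context d (X : measurableType d) (m : probability X R) (N : Cc G R -> X -> C).

(* Products of n.+1 factors: the empty product is not included. *)
Definition Cc_product (f : X -> C) :=
  exists n (theta : 'I_n.+1 -> Cc C R) (phi : 'I_n.+1 -> Cc G R),
    f = fun x => \prod_(j < n.+1) (theta j (N (phi j) x) : R[i]).

Definition full_process :=
  forall f, Lp m 2%:E f -> forall e : R, 0 < e ->
    exists k (c : 'I_k -> R[i]) (p : 'I_k -> X -> C),
      (forall i, Cc_product (p i)) /\
      (Lp_norm m 2%:E (f - \sum_(i < k) c i *: p i)%R < e%:E)%E.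

End full.

Definition equivalent_processes d d' (X : measurableType d) (X' : measurableType d')
    (alpha : G -> X -> X) (m : probability X R) (N : Cc G R -> X -> C)
    (alpha' : G -> X' -> X') (m' : probability X' R) (N' : Cc G R -> X' -> C) :=
  exists (U : (X -> C) -> (X' -> C)) (V : (X' -> C) -> (X -> C)),
    [/\ L2_unitary m m' U V,
      forall phi, U (N phi) = N' phi %[ae m'],
      forall t f, Lp m 2%:E f ->
        U (koopman alpha t f) = koopman alpha' t (U f) %[ae m'],
      multiplicative_on_Linf m m' U & multiplicative_on_Linf m' m V].

Definition is_PMDS (m' : probability (pmeasure G R) R) :=
  invariant_measure (@pmeasure_act G R) m' /\
  forall phi, (\int[m']_nu (normc (pmeasure_eval phi nu) ^+ 2)%R%:E < +oo)%E.

End spatial_processes.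

(* Main.v *)
(* A countable family e of nonnegative functions in C_c(G) (partitions of unity
   subordinate to a countable base) approximates every real phi in C_c(G) with an
   error eps * chi, where chi is a fixed combination of members of e.  Hence a
   positive functional on C_c(G) is determined by its values on e, and any values
   that are nonnegative on the nonnegative rational combinations come from one.
   For almost every w the numbers N(e_i)(w) have this property, which is a
   countable condition; the resulting positive measure Phi(w) satisfies
   Phi(w)(phi) = N(phi)(w) almost everywhere for each phi.  The map Phi is
   measurable because the vague topology of the positive measures is generated by
   countably many boxes in the coordinates nu(e_i).  Let m' be the image of m under
   Phi.  Then g |-> g o Phi is an isometric, multiplicative embedding of L^2(m')
   into L^2(m) which intertwines the actions; its range is closed and contains the
   products in the definition of fullness, so it is onto. *)
From HB Require Import structures.
Require Import Defs.
From mathcomp Require Import all_boot all_order all_algebra.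
From mathcomp Require Import all_classical all_reals all_analysis.
From mathcomp Require Import measurable_realfun ess_sup_inf.
From mathcomp.real_closed Require Import complex.
From mathcomp Require Import ring lra.

Set Implicit Arguments.
Unset Strict Implicit.
Unset Printing Implicit Defensive.

Import Order.TTheory GRing.Theory Num.Theory.
Import numFieldNormedType.Exports.

Local Open Scope classical_set_scope.
Local Open Scope complex_scope.
Local Open Scope ring_scope.

(** * Approximation by a countable family *)

(** Each relation that a measure has to satisfy holds off a null set that depends on the functions
    involved, and C_c(G) is uncountable; hence the reduction to a countable family. The error is eps
    * chi rather than a uniform eps because a positive functional need not be bounded for the sup
    norm: it is controlled only through a dominating function. Since chi is chosen before eps, the
    bound eps * nu(chi) tends to 0. The family may satisfy linear relations, which the values
    N(e_i)(w) respect only almost everywhere; positivity on combinations takes care of them too, as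
    it forces equal combinations to receive equal values. On all of M(G) countably many evaluations
    need not control the vague topology; on the positive measures they do, because nu(chi) itself
    bounds the errors. Finally, Phi need be neither injective nor onto, so a limit of functions g_k
    o Phi has to be rebuilt on the target space. *)

Lemma compact_finite_cover (T : topologicalType) (I : eqType) (K : set T)
    (P : I -> set T) : compact K ->
  (forall x, K x -> exists i, \forall y \near x, P i y) ->
  exists s : seq I, forall y, K y -> exists2 i, i \in s & P i y.
Proof.
move=> /compact_near_coveringP cK KP.
(* Finite lists ordered by inclusion: a property that holds near every point of [K] along this
   filter holds on all of [K] for one list. *)
pose F := filter_from [set: seq I] (fun s0 => [set s : seq I | {subset s0 <= s}]).
have FF : Filter F.
  apply: filter_from_filter; first by exists [::].
  move=> s t _ _; exists (s ++ t) => // u /= stu.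
  by split=> x xs; apply: stu; rewrite mem_cat xs ?orbT.
have [x Kx|s0 _] := cK _ F (fun s y => exists2 i, i \in s & P i y) FF.
  have [i Pi] := KP x Kx.
  exists (P i, [set s : seq I | i \in s]) => /=.
    split => //; exists [:: i] => // s /= is_; apply: is_; exact: mem_head.
  by move=> [y s] /= [Piy is_]; exists i.
by move=> /(_ s0 (fun _ => id)) s0P; exists s0.
Qed.

(** * Countably many bump functions on a locally compact second countable space *)

Section bumps.
Variables (R : realType) (T : topologicalType).
Hypothesis hT : hausdorff_space T.
Hypothesis lT : locally_compact [set: T].

Definition compactly_supported (f : T -> R) :=
  compact (closure [set x | f x != 0]).

Lemma compactly_supported_sub (f : T -> R) (K : set T) : compact K ->
  (forall x, ~ K x -> f x = 0) -> compactly_supported f.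
Proof.
move=> cK fK; apply: (subclosed_compact (@closed_closure _ _) cK).
rewrite [X in _ `<=` X](iffLR (closure_id K)); last exact: compact_closed hT cK.
by apply: closureS => x /= fx; apply: contrapT => /fK/eqP; apply/negP.
Qed.

Lemma locally_compact_nbhs (x : T) : exists2 U, nbhs x U & compact U.
Proof. by have [U] := lT (I : setT x); rewrite withinET => nU [cU _]; exists U. Qed.

Lemma bump_exists (x : T) (V : set T) : nbhs x V ->
  exists f : T -> R, [/\ continuous f, forall y, 0 <= f y,
    \forall y \near x, 1 <= f y & forall y, ~ V y -> f y = 0].
Proof.
rewrite nbhsE => -[V' [oV' V'x] V'V].
have sep : @uniform_separator T [set x] (~` V').
  apply: (locally_compact_completely_regular (R := R)) => //.
  exact: open_closedC.
(* [1 - f] may reach 1 only at [x]; its double is at least 1 wherever [f < 1/2], which is a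
   neighborhood of [x]. *)
pose f : T -> R := Urysohn [set x] (~` V'); exists (fun y => (1 - f y) + (1 - f y)).
have cf : continuous f by exact: Urysohn_continuous.
have f01 y : 0 <= f y <= 1.
  by have := @Urysohn_range _ _ [set x] (~` V') (f y); rewrite set_itvcc; apply; exists y.
have fx : f x = 0 by apply: (@Urysohn_sub0 _ _ _ _ sep); exists x.
split.
- move=> y; by apply: cvgD; apply: cvgB => //; (exact: cvg_cst || exact: cf).
- by move=> y; rewrite addr_ge0// subr_ge0; case/andP: (f01 y).
- have : \forall y \near x, f y < 2^-1.
    have : f @ x --> f x by exact: cf.
    rewrite fx => /cvgrPdist_lt/(_ 2^-1); rewrite invr_gt0 ltr0n.
    move=> /(_ isT); apply: filterS => y; rewrite sub0r normrN.
    exact: le_lt_trans (ler_norm _).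
  by apply: filterS => y fy; lra.
- move=> y Vy; suff -> : f y = 1 by rewrite subrr addr0.
  by apply: (@Urysohn_sub1 _ _ _ _ sep); exists y => // /V'V.
Qed.

Hypothesis sT : @second_countable T.

(** A pair of basic open sets admits many functions that are at least 1 on the first and vanish off
    the second, but one per pair suffices, and there are countably many pairs. *)
Lemma countable_bumps : exists f : nat * nat -> T -> R,
  [/\ forall i, continuous (f i), forall i x, 0 <= f i x,
      forall i, compactly_supported (f i) &
      forall (x : T) V, nbhs x V -> exists i, (\forall y \near x, 1 <= f i y) /\
        forall y, ~ V y -> f i y = 0].
Proof.
have [B cB [oB nB]] := sT.
have [h hB] : exists h : set T -> nat, {in B &, injective h}.
  have /countable_injP[h] := cB.
  by exists h.
(* An inverse of [h]; numbers that index no basic set decode to the empty set. *)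
pose U n := xget set0 [set U | B U /\ h U = n].
have UE V : B V -> U (h V) = V.
  move=> BV; rewrite /U; case: xgetP => [W _ [BW /hB]|/(_ V)].
    by apply; apply/mem_set.
  by case.
pose P (i : nat * nat) (g : T -> R) := [/\ continuous g, forall x, 0 <= g x,
  compactly_supported g, forall y, U i.1 y -> 1 <= g y &
  forall y, ~ U i.2 y -> g y = 0].
(* A pair without an admissible function gets 0, which is still continuous, nonnegative and
   compactly supported. *)
have exf i : exists g, (P i g \/ g = 0) /\ ((exists g', P i g') -> P i g).
  have [[g' Pg']|n] := pselect (exists g', P i g'); first by exists g'; split=> //; left.
  by exists 0; split; [right|move=> /n].
have [f fP] := choice exf.
exists f; split => [i|i x|i|x V Vx].
- by have [[[]//|->]] := fP i; move=> _ x; exact: cvg_cst.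
- by have [[[]//|->]] := fP i.
- have [[[]//|->] _] := fP i.
  by apply: (@compactly_supported_sub _ set0) => //; exact: compact0.
- have [C xC cC] := locally_compact_nbhs x.
  have [W [BW Wx WVC]] := nB x _ (filterI Vx xC).
  have nW : nbhs x W by apply: open_nbhs_nbhs; split => //; exact: oB.
  have [g [cg g0 g1 gW]] := bump_exists nW.
  have [W1 [BW1 W1x W1g]] := nB x _ g1.
  exists (h W1, h W).
  have [] : P (h W1, h W) (f (h W1, h W)).
    apply: (fP _).2; exists g; split => //=.
    + by apply: (compactly_supported_sub cC) => y Cy; apply: gW => /WVC[].
    + by move=> y; rewrite UE// => /W1g.
    + by move=> y; rewrite UE//; exact: gW.
  rewrite /= !UE// => _ _ _ f1 fW; split.
    suff : nbhs x W1 by apply: filterS.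
    by apply: open_nbhs_nbhs; split => //; exact: oB.
  by move=> y Vy; apply: fW => /WVC[].
Qed.

End bumps.

(** * Approximation relative to a fixed dominating combination *)

Section approximation.
Variables (R : realType) (T : topologicalType).

Definition lincomb (V : lmodType R) (I : Type) (v : I -> V) (s : seq (R * I)) : V :=
  \sum_(p <- s) p.1 *: v p.2.

Definition scale_seq (I : Type) (a : R) (s : seq (R * I)) :=
  [seq (a * p.1, p.2) | p <- s].

Lemma lincomb_cat (V : lmodType R) (I : Type) (v : I -> V) s t :
  lincomb v (s ++ t) = lincomb v s + lincomb v t.
Proof. exact: big_cat. Qed.

Lemma lincomb_scale (V : lmodType R) (I : Type) (v : I -> V) a s :
  lincomb v (scale_seq a s) = a *: lincomb v s.
Proof.
rewrite /lincomb big_map scaler_sumr; apply: eq_bigr => p _ /=.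
by rewrite scalerA.
Qed.

Lemma lincomb_fun (I : Type) (v : I -> T -> R) s x :
  lincomb (v : I -> (T -> R^o)) s x = \sum_(p <- s) p.1 * v p.2 x.
Proof. by rewrite /lincomb fct_sumE. Qed.

(* In [approximating_dense], [s0] does not depend on [eps]: a positive functional
   [nu] then satisfies [|nu phi - nu (E s)| <= eps * nu (E s0)]. *)
Record approximating (I : Type) (e : I -> T -> R) : Prop := {
  approximating_continuous : forall i, continuous (e i) ;
  approximating_ge0 : forall i x, 0 <= e i x ;
  approximating_supp : forall i, compactly_supported (e i) ;
  approximating_dominate : forall K, compact K ->
    exists2 s, (forall x, 0 <= lincomb (e : I -> (T -> R^o)) s x) &
      forall x, K x -> \forall y \near x, 1 <= lincomb (e : I -> (T -> R^o)) s y ;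
  approximating_dense : forall phi : T -> R, continuous phi ->
    compactly_supported phi ->
    exists2 s0, (forall x, 0 <= lincomb (e : I -> (T -> R^o)) s0 x) &
      forall eps, 0 < eps -> exists s, forall x,
        `|phi x - lincomb (e : I -> (T -> R^o)) s x|
          <= eps * lincomb (e : I -> (T -> R^o)) s0 x }.

(* The family consists of all the [f i / max (\sum_(j <- l) f j) 1]; for the [l]
   that cover the support of [phi] these are partitions of unity there. *)
Section partition.
Variables (J : eqType) (f : J -> T -> R).
Hypothesis cf : forall i, continuous (f i).
Hypothesis f0 : forall i x, 0 <= f i x.
Hypothesis sf : forall i, compactly_supported (f i).
Hypothesis bf : forall (x : T) V, nbhs x V ->
  exists i, (\forall y \near x, 1 <= f i y) /\ forall y, ~ V y -> f i y = 0.

Let M (l : seq J) (x : T) : R := Num.max (\sum_(j <- l) f j x) 1.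

Let M_gt0 l x : 0 < M l x. Proof. by rewrite /M lt_max ltr01 orbT. Qed.

Let e (p : seq J * J) (x : T) : R := f p.2 x / M p.1 x.

Let cM l : continuous (M l).
Proof.
move=> x; apply: continuous_max; last exact: cvg_cst.
elim: l => [|j l IH].
  rewrite (_ : (fun _ => _) = cst 0); first exact: cvg_cst.
  by apply/funext => y; rewrite big_nil.
rewrite (_ : (fun _ => _) = (fun y => f j y + \sum_(j <- l) f j y)).
  by apply: cvgD => //; exact: cf.
by apply/funext => y; rewrite big_cons.
Qed.

Let e_ge0 p x : 0 <= e p x. Proof. by rewrite divr_ge0// ltW. Qed.

Let e_dominate K : compact K ->
  exists2 s, (forall x, 0 <= lincomb (e : _ -> (T -> R^o)) s x) &
      forall x, K x -> \forall y \near x, 1 <= lincomb (e : _ -> (T -> R^o)) s y.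
Proof.
move=> cK.
(* Interiors, because the lower bound is wanted near each point of [K] and not only on [K]. *)
have [|l lK] := @compact_finite_cover T J K
    (fun i => interior [set z | 1 <= f i z]) cK.
  move=> x _; have [i [fi _]] := bf (@filterT _ (nbhs x) _).
  by exists i; exact: nbhs_interior.
exists [seq (1, (l, i)) | i <- l] => [x|x Kx].
  by rewrite lincomb_fun big_map sumr_ge0// => i _ /=; rewrite mul1r.
have [i il] := lK x Kx; apply: filterS => y /= fiy.
rewrite lincomb_fun big_map /= /e /=.
under eq_bigr do rewrite mul1r.
rewrite -mulr_suml ler_pdivlMr// mul1r /M ge_max lexx/=.
by rewrite (big_rem i)//= (le_trans fiy)// lerDl sumr_ge0.
Qed.

Lemma partition_approximating : approximating e.
Proof.
split=> [p x|//|p|//|phi cphi sphi].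
- apply: cvgM; first exact: cf.
  by apply: cvgV; [rewrite gt_eqF|exact: cM].
- have := @sf p.2; rewrite /compactly_supported.
  move=> /(subclosed_compact (@closed_closure _ _)); apply.
  by apply: closureS => x /=; apply: contra_neq; rewrite /e => ->; rewrite mul0r.
have [s0 s00 s01] := e_dominate sphi.
set E0 := lincomb _ s0 in s00 s01 *.
exists s0 => // eps eps0.
(* Points with the same index [i] may have different values of [phi], hence the
   cover is indexed by pairs. *)
pose Q (p : R * J) := forall z, f p.2 z != 0 -> `|phi z - p.1| < eps /\ 1 <= E0 z.
have [|s sK] := @compact_finite_cover T (R * J)%type _
    (fun p => [set z | 1 <= f p.2 z /\ Q p]) sphi.
  move=> x Kx.
  have /cvgrPdist_lt/(_ _ eps0) : phi @ x --> phi x by exact: cphi.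
  move=> /(filterI (s01 x Kx))/bf[i [f1 fV]]; exists (phi x, i).
  near=> z; split; first by near: z; exact: f1.
  move=> y fy /=; have [[]|/fV] := pselect (1 <= E0 y /\ `|phi x - phi y| < eps).
    by rewrite distrC.
  by move=> fy0; rewrite fy0 eqxx in fy.
(* The finite cover may contain pairs without [Q]; they serve no point and are discarded. *)
pose s' := [seq p <- s | `[< Q p >]]; pose l := map snd s'.
exists [seq (p.1, (l, p.2)) | p <- s'] => x.
rewrite lincomb_fun big_map /= /e /=.
set S := \sum_(p <- s') f p.2 x.
have S0 : 0 <= S by rewrite sumr_ge0.
have ME : M l x = Num.max S 1 by rewrite /M big_map.
(* On the support of [phi] the remaining bumps have sum at least 1, so the weights add up to exactly
   1; elsewhere both sides are 0. *)
have phiE : phi x = \sum_(p <- s') phi x * (f p.2 x / M l x).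
  have [Kx|nKx] := pselect (closure [set x | phi x != 0] x).
    rewrite -mulr_sumr -mulr_suml -/S.
    suff S1 : 1 <= S.
      rewrite ME max_l// divff ?mulr1// gt_eqF//; lra.
    have [p ps [fp1 Qp]] := sK x Kx.
    have ps' : p \in s' by rewrite mem_filter ps andbT; exact/asboolP.
    by rewrite /S (big_rem p)//= (le_trans fp1)// lerDl sumr_ge0.
  have -> : phi x = 0.
    by apply/eqP/negPn/negP => px; apply: nKx; exact: subset_closure.
  by rewrite big1// => p _; rewrite mul0r.
rewrite {1}phiE -sumrB.
under eq_bigr do rewrite -mulrBl.
apply: (le_trans (ler_norm_sum _ _ _)).
apply: (@le_trans _ _ (\sum_(p <- s') eps * (f p.2 x / M l x))).
  rewrite big_seq [leRHS]big_seq ler_sum// => p.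
  rewrite mem_filter => /andP[/asboolP Qp _].
  have [->|/Qp[d _]] := eqVneq (f p.2 x) 0; first by rewrite !mul0r !mulr0 normr0.
  have fM : 0 <= f p.2 x / M l x by rewrite divr_ge0// ltW.
  by rewrite normrM [`|_ / _|]ger0_norm// ler_wpM2r// ltW.
rewrite -mulr_sumr ler_pM2l// -mulr_suml -/S ME.
(* The weights add up to at most 1, and they all vanish unless some remaining bump is nonzero at
   [x], where [Q] gives [1 <= E0 x]. *)
have [S00|Sn0] := eqVneq S 0; first by rewrite S00 mul0r.
have S1 : S / Num.max S 1 <= 1.
  by rewrite ler_pdivrMr ?lt_max ?ltr01 ?orbT// mul1r le_max lexx.
apply: (le_trans S1).
have [p] : exists2 p, p \in s' & f p.2 x != 0.
  apply: contrapT => nex; move/eqP: Sn0; apply.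
  rewrite /S big_seq big1// => p ps; apply/eqP/negPn/negP => fp.
  by apply: nex; exists p.
by rewrite mem_filter => /andP[/asboolP Qp _] /Qp[].
Unshelve. all: by end_near. Qed.

End partition.

End approximation.

Lemma countable_approximating (R : realType) (T : topologicalType) :
  hausdorff_space T -> locally_compact [set: T] -> @second_countable T ->
  exists e : seq (nat * nat) * (nat * nat) -> T -> R, approximating e.
Proof.
move=> hT lT sT; have [f [cf f0 sf bf]] := @countable_bumps R T hT lT sT.
by eexists; exact: (partition_approximating cf f0 sf bf).
Qed.

(** * Positive functionals on real functions *)

Section complex_topology.
Variable R : realType.
Local Notation C := (R[i]^o).
Import ComplexField.Normc.

Lemma complexE_pair (z : R[i]) : z = complex.Re z +i* complex.Im z.
Proof. by case: z. Qed.

Lemma ReB (x y : R[i]) : complex.Re (x - y) = complex.Re x - complex.Re y.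
Proof. by case: x y => [? ?] [? ?]. Qed.

Lemma ImB (x y : R[i]) : complex.Im (x - y) = complex.Im x - complex.Im y.
Proof. by case: x y => [? ?] [? ?]. Qed.

Lemma normc_ge0 (z : R[i]) : 0 <= normc z.
Proof. by rewrite -ler0c -normcEC. Qed.

Lemma normr_Re_le (z : R[i]) : `|complex.Re z| <= normc z.
Proof.
case: z => a b /=; rewrite -sqrtr_sqr ler_wsqrtr// lerDl; exact: sqr_ge0.
Qed.

Lemma normr_Im_le (z : R[i]) : `|complex.Im z| <= normc z.
Proof.
case: z => a b /=; rewrite -sqrtr_sqr ler_wsqrtr// lerDr; exact: sqr_ge0.
Qed.

Lemma normc_le_ReIm (z : R[i]) : normc z <= `|complex.Re z| + `|complex.Im z|.
Proof.
case: z => a b /=; rewrite -[leRHS]ger0_norm ?addr_ge0// -sqrtr_sqr ler_wsqrtr//.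
rewrite sqrrD !real_normK ?num_real//.
by have : 0 <= `|a| * `|b| *+ 2; [rewrite mulrn_wge0// mulr_ge0|lra].
Qed.

(** The norm of [R[i]] takes values in [R[i]], so the tolerance [e] is a complex number; being
    positive in the order of [R[i]], it is real. *)
Lemma cvgC_normc (T : Type) (F : set_system T) (FF : Filter F) (f : T -> C) (z : C) :
  (forall e : R, 0 < e -> \forall t \near F, normc (z - f t) < e) -> f @ F --> z.
Proof.
move=> h; apply/(@cvgrPdist_lt _ _ _ _ FF) => e e0.
have eE : e = (complex.Re e)%:C.
  by case: e e0 => a b; rewrite ltcE /= => /andP[/eqP -> _].
have := h (complex.Re e); rewrite -ltcR -eE => /(_ e0); apply: filterS => t.
by rewrite eE -ltcR -normcEC.
Qed.

Lemma normc_cvgC (T : Type) (F : set_system T) (FF : Filter F) (f : T -> C) (z : C) :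
  f @ F --> z -> forall e : R, 0 < e -> \forall t \near F, normc (z - f t) < e.
Proof.
move=> /(@cvgrPdist_lt _ _ _ _ FF) h e e0.
have := h e%:C; rewrite ltcR => /(_ e0); apply: filterS => t.
by rewrite normcEC ltcR.
Qed.

Lemma Re_continuous : continuous (fun z : C => complex.Re z : R).
Proof.
move=> z; apply/(@cvgrPdist_lt _ _ _ _ (nbhs_filter z)) => e e0.
have zz : (id : C -> C) @ z --> z by exact: cvg_id.
have := normc_cvgC (nbhs_filter z) zz e0; apply: filterS => t.
by apply: le_lt_trans; rewrite -ReB normr_Re_le.
Qed.

Lemma Im_continuous : continuous (fun z : C => complex.Im z : R).
Proof.
move=> z; apply/(@cvgrPdist_lt _ _ _ _ (nbhs_filter z)) => e e0.
have zz : (id : C -> C) @ z --> z by exact: cvg_id.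
have := normc_cvgC (nbhs_filter z) zz e0; apply: filterS => t.
by apply: le_lt_trans; rewrite -ImB normr_Im_le.
Qed.

Lemma real_complex_continuous : continuous (fun r : R => (r%:C : C)).
Proof.
move=> r; apply: (cvgC_normc (nbhs_filter r)) => e e0.
have /cvgrPdist_lt/(_ _ e0) : id @ r --> r by exact: cvg_id.
apply: filterS => t; rewrite -rmorphB /=.
by rewrite expr0n addr0 sqrtr_sqr.
Qed.

End complex_topology.

(** * Real and imaginary parts of functions in C_c *)

Section Cc_real.
Variables (T : topologicalType) (R : realType).
Local Notation C := (R[i]^o).
Import ComplexField.Normc.

Definition real_Cc : set (T -> R) :=
  [set f | continuous f /\ compactly_supported f].

Lemma Cc_real_subproof (f : T -> R) : real_Cc f ->
  (fun x => (f x)%:C) \in @Cc_pred T R.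
Proof.
move=> [cf sf]; apply/Cc_predP; split.
  by move=> x; apply: continuous_comp; [exact: cf|exact: real_complex_continuous].
apply: (subclosed_compact (@closed_closure _ _) sf).
by apply: closureS => x /=; apply: contra_neq => ->.
Qed.

Definition Cc_real (f : T -> R) (rf : real_Cc f) : Cc T R :=
  MkCc (Cc_real_subproof rf).

Lemma real_Cc_Re (phi : Cc T R) : real_Cc (fun x => complex.Re (phi x)).
Proof.
have /Cc_predP [cphi kphi] := Cc_funP phi; split.
  by move=> x; apply: continuous_comp; [exact: cphi|exact: Re_continuous].
apply: (subclosed_compact (@closed_closure _ _) kphi).
by apply: closureS => x /=; apply: contra_neq => ->.
Qed.

Lemma real_Cc_Im (phi : Cc T R) : real_Cc (fun x => complex.Im (phi x)).
Proof.
have /Cc_predP [cphi kphi] := Cc_funP phi; split.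
  by move=> x; apply: continuous_comp; [exact: cphi|exact: Im_continuous].
apply: (subclosed_compact (@closed_closure _ _) kphi).
by apply: closureS => x /=; apply: contra_neq => ->.
Qed.

Lemma real_Cc_lin (a : R) (f g : T -> R) : real_Cc f -> real_Cc g ->
  real_Cc (fun x => a * f x + g x).
Proof.
move=> [cf sf] [cg sg]; split.
  move=> x; apply: cvgD; last exact: cg.
  by apply: cvgM; [exact: cvg_cst|exact: cf].
apply: (subclosed_compact (@closed_closure _ _) (compactU sf sg)).
rewrite -closureU; apply: closureS => x /= h.
have [fx0|] := eqVneq (f x) 0; last by left.
by right; apply: contra_neq h => ->; rewrite fx0 mulr0 addr0.
Qed.

Lemma real_Cc0 : real_Cc (fun=> 0).
Proof.
split; first by move=> x; exact: cvg_cst.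
rewrite /compactly_supported (_ : [set x | _] = set0) ?closure0; first exact: compact0.
by rewrite -subset0 => x /=; rewrite eqxx.
Qed.

Lemma Cc_ReIm (phi : Cc T R) :
  phi = 'i%C *: Cc_real (real_Cc_Im phi) + Cc_real (real_Cc_Re phi).
Proof.
apply/val_inj/funext => x /=; rewrite [LHS]complexE addrC; congr (_ + _).
Qed.

End Cc_real.

Lemma ler_addgt0M (R : realType) (a b c : R) :
  (forall eps, 0 < eps -> a <= b + eps * c) -> a <= b.
Proof.
move=> h; rewrite leNgt; apply/negP => ba.
have c0 : 0 < c.
  by have := h 1 ltr01; rewrite mul1r => h1; lra.
have := h ((a - b) / 2 / c); rewrite divr_gt0 ?divr_gt0 ?subr_gt0// => /(_ isT).
by rewrite divfK ?gt_eqF// => h1; lra.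
Qed.

(* Positive real functionals on real_Cc are determined by their values on an
   approximating family, and any values compatible with positivity on the span
   of the family define one. *)
Section positive_extension.
Variables (R : realType) (T : topologicalType) (I : Type) (e : I -> T -> R).
Hypothesis He : approximating e.
Local Notation E s := (lincomb (e : _ -> (T -> R^o)) s).

Lemma lincomb_fun_cat s t x : E (s ++ t) x = E s x + E t x.
Proof. by rewrite lincomb_cat. Qed.

Lemma lincomb_fun_scale a s x : E (scale_seq a s) x = a * E s x.
Proof. by rewrite lincomb_scale. Qed.

Section fixed_values.
Variable n : I -> R.
Local Notation L s := (lincomb (n : _ -> R^o) s).
Hypothesis n_ge0 : forall s, (forall x, 0 <= E s x) -> 0 <= L s.

Lemma lincomb_values_cat s t : L (s ++ t) = L s + L t :> R.
Proof. exact: lincomb_cat. Qed.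

Lemma lincomb_values_scale a s : L (scale_seq a s) = a * L s :> R.
Proof. exact: lincomb_scale. Qed.

(** Used in both directions, it shows that [L] depends only on the function that a list represents,
    although [n] is not assumed to respect linear relations in the family. *)
Lemma lincomb_mono s t : (forall x, E s x <= E t x) -> L s <= L t.
Proof.
move=> st; have := n_ge0 (s := t ++ scale_seq (-1) s).
rewrite lincomb_values_cat lincomb_values_scale mulN1r subr_ge0; apply => x.
by rewrite lincomb_fun_cat lincomb_fun_scale mulN1r subr_ge0.
Qed.

(** The inequalities that monotonicity imposes on the value at [phi] of any positive functional
    extending [n]. On [real_Cc] they have exactly one solution, so linearity is proved by solving
    them rather than by computing with suprema. *)
Definition dominated_value (phi : T -> R) (a : R) := forall s,
  ((forall x, E s x <= phi x) -> L s <= a) /\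
  ((forall x, phi x <= E s x) -> a <= L s).

Lemma dominated_value_dist phi a eps s s0 : dominated_value phi a ->
  (forall x, `|phi x - E s x| <= eps * E s0 x) -> `|a - L s| <= eps * L s0.
Proof.
move=> Ha h; rewrite ler_distl.
have [+ _] := Ha (s ++ scale_seq (- eps) s0).
have [_ +] := Ha (s ++ scale_seq eps s0).
rewrite !lincomb_values_cat !lincomb_values_scale mulNr => h1 h2.
apply/andP; split; [apply: h2|apply: h1] => x; have := h x;
  rewrite ler_distl lincomb_fun_cat lincomb_fun_scale ?mulNr => /andP[] //.
Qed.

(** Both values lie within [eps * L s0] of the same [L s], and [s0] does not change with [eps]. *)
Lemma dominated_value_uniq phi a b : real_Cc phi ->
  dominated_value phi a -> dominated_value phi b -> a = b.
Proof.
move=> [cphi sphi].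
have [s0 s00 hs0] := approximating_dense He cphi sphi.
suff : forall a b, dominated_value phi a -> dominated_value phi b -> a <= b.
  by move=> h ha hb; apply/eqP; rewrite eq_le !h.
move=> {}a {}b ha hb; apply: (@ler_addgt0M _ _ _ (2 * L s0)) => eps e0.
have [s hs] := hs0 eps e0.
have := dominated_value_dist ha hs; have := dominated_value_dist hb hs.
rewrite !ler_distl => /andP[h1 h2] /andP[h3 h4]; lra.
Qed.

Lemma dominated_value_lin c phi psi a b : real_Cc phi -> real_Cc psi ->
  dominated_value phi a -> dominated_value psi b ->
  dominated_value (fun x => c * phi x + psi x) (c * a + b).
Proof.
move=> [cphi kphi] [cpsi kpsi] ha hb.
have [u0 u00 hu0] := approximating_dense He cphi kphi.
have [v0 v00 hv0] := approximating_dense He cpsi kpsi.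
(* A negative [c] exchanges minorants and majorants, so both functions are approximated from two
   sides and the error carries [|c|]. *)
have key eps : 0 < eps -> exists w,
    (forall x, `|c * phi x + psi x - E w x| <= eps * (`|c| * E u0 x + E v0 x)) /\
    `|c * a + b - L w| <= eps * (`|c| * L u0 + L v0).
  move=> e0; have [u hu] := hu0 eps e0; have [v hv] := hv0 eps e0.
  have aux (x y x' y' p q : R) : `|x - x'| <= eps * p -> `|y - y'| <= eps * q ->
      `|c * x + y - (c * x' + y')| <= eps * (`|c| * p + q).
    move=> h1 h2; rewrite opprD addrACA -mulrBr (le_trans (ler_normD _ _))//.
    by rewrite [leRHS]mulrDr lerD// normrM mulrCA ler_wpM2l.
  exists (scale_seq c u ++ v); split=> [x|].
    by rewrite lincomb_fun_cat lincomb_fun_scale; exact: aux.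
  rewrite lincomb_values_cat lincomb_values_scale; apply: aux.
    exact: dominated_value_dist ha hu.
  exact: dominated_value_dist hb hv.
pose w0 := scale_seq `|c| u0 ++ v0.
have w0E x : E w0 x = `|c| * E u0 x + E v0 x.
  by rewrite lincomb_fun_cat lincomb_fun_scale.
have w0L : L w0 = `|c| * L u0 + L v0 by rewrite lincomb_values_cat lincomb_values_scale.
(* The factor 2: one error [eps * L w0] between [c * a + b] and [L w], another in the comparison of
   [s] with [w]. *)
move=> s; split=> hs; apply: (@ler_addgt0M _ _ _ (2 * L w0)) => eps e0;
  have [w [hw]] := key eps e0; rewrite -w0L ler_distl => /andP[h1 h2].
  have := @lincomb_mono s (w ++ scale_seq eps w0).
  rewrite lincomb_values_cat lincomb_values_scale => h3.
  suff : L s <= L w + eps * L w0 by lra.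
  apply: h3 => x; rewrite lincomb_fun_cat lincomb_fun_scale w0E.
  by have := hw x; have := hs x; rewrite ler_distl => ? /andP[? ?]; lra.
have := @lincomb_mono (w ++ scale_seq (- eps) w0) s.
rewrite lincomb_values_cat lincomb_values_scale => h3.
suff : L w + - eps * L w0 <= L s by lra.
apply: h3 => x; rewrite lincomb_fun_cat lincomb_fun_scale w0E.
by have := hw x; have := hs x; rewrite ler_distl => ? /andP[? ?]; lra.
Qed.

(** A lower integral: the supremum over the combinations below [phi]. *)
Definition extension (phi : T -> R) : R :=
  sup [set L s | s in [set s | forall x, E s x <= phi x]].

Lemma extension_dominated phi : real_Cc phi -> dominated_value phi (extension phi).
Proof.
move=> [cphi kphi].
have [s0 s00 hs0] := approximating_dense He cphi kphi.
(* At precision 1, [s1 - s0] is a minorant and [s1 + s0] a majorant, so the set of lower values is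
   nonempty and bounded. *)
have [s1 hs1] := hs0 1 ltr01.
have ne : [set L s | s in [set s | forall x, E s x <= phi x]] !=set0.
  exists (L (s1 ++ scale_seq (-1) s0)); exists (s1 ++ scale_seq (-1) s0) => //= x.
  have := hs1 x; rewrite lincomb_fun_cat lincomb_fun_scale ler_distl.
  by move=> /andP[? ?]; lra.
have ub s : (forall x, phi x <= E s x) -> 
    ubound [set L s | s in [set s | forall x, E s x <= phi x]] (L s).
  move=> hs _ [t ht <-]; apply: lincomb_mono => x.
  exact: (le_trans (ht x) (hs x)).
move=> s; split=> hs.
  apply: ub_le_sup; last by exists s.
  exists (L (s1 ++ s0)); apply: ub => x.
  have := hs1 x; rewrite lincomb_fun_cat ler_distl.
  by move=> /andP[? ?]; lra.
by apply: ge_sup => //; exact: ub.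
Qed.

Lemma extension_lin c phi psi : real_Cc phi -> real_Cc psi ->
  extension (fun x => c * phi x + psi x) = c * extension phi + extension psi.
Proof.
move=> rphi rpsi; apply: (@dominated_value_uniq (fun x => c * phi x + psi x)).
- exact: real_Cc_lin.
- by apply: extension_dominated; exact: real_Cc_lin.
- by apply: dominated_value_lin => //; exact: extension_dominated.
Qed.

Lemma extension0 : extension (fun=> 0) = 0.
Proof.
transitivity (-1 * extension (fun=> 0) + extension (fun=> 0)).
  rewrite -(extension_lin _ (real_Cc0 T R) (real_Cc0 T R)); congr extension.
  by apply/funext => x; rewrite mulr0 addr0.
by rewrite mulN1r addNr.
Qed.

Lemma extension_family i : extension (e i) = n i.
Proof.
have L1 : L [:: (1, i)] = n i by rewrite /lincomb big_seq1 scale1r.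
have E1 x : E [:: (1, i)] x = e i x by rewrite /lincomb big_seq1 scale1r.
have re : real_Cc (e i).
  by split; [exact: approximating_continuous|exact: approximating_supp].
apply: (dominated_value_uniq re); first exact: extension_dominated.
by move=> s; rewrite -L1; split=> hs; apply: lincomb_mono => x; rewrite E1.
Qed.

Lemma extension_ge0 phi : real_Cc phi -> (forall x, 0 <= phi x) -> 0 <= extension phi.
Proof.
move=> rphi phi0; have [+ _] := extension_dominated rphi [::].
rewrite [L [::]]big_nil; apply => x.
by rewrite lincomb_fun big_nil.
Qed.

(** The empty list is the approximant. This estimate later gives the continuity of the functional on
    C_c(G). *)
Lemma extension_bound phi s eps : real_Cc phi ->
  (forall x, `|phi x| <= eps * E s x) -> `|extension phi| <= eps * L s.
Proof.
move=> rphi h; have := @dominated_value_dist phi _ eps [::] s (extension_dominated rphi).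
rewrite [L [::]]big_nil subr0; apply => x.
by rewrite lincomb_fun big_nil subr0.
Qed.

End fixed_values.

(* Upward perturbation of the real coefficients keeps a nonnegative combination
   nonnegative because the family is nonnegative. *)
Lemma rational_positivity (n : I -> R) :
  (forall s : seq (rat * I), (forall x, 0 <= E [seq (ratr p.1, p.2) | p <- s] x) ->
    0 <= lincomb (n : _ -> R^o) [seq (ratr p.1, p.2) | p <- s]) ->
  forall s, (forall x, 0 <= E s x) -> 0 <= lincomb (n : _ -> R^o) s.
Proof.
move=> n0 s hs.
have n_ge0 i : 0 <= n i.
  have := n0 [:: (1, i)]; rewrite /= rmorph1 [lincomb (n : _ -> R^o) _]big_seq1 scale1r.
  by apply => x; rewrite lincomb_fun big_seq1 mul1r; exact: approximating_ge0.
apply: (@ler_addgt0M _ _ _ (\sum_(p <- s) n p.2)) => eps eps0.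
have /choice[q hq] (c : R) : exists q : rat, c < ratr q < c + eps.
  have /rat_in_itvoo[q] : c < c + eps by rewrite ltrDl.
  by rewrite in_itv => hq; exists q.
apply: (le_trans (n0 [seq (q p.1, p.2) | p <- s] _)).
  move=> x; rewrite (le_trans (hs x))// !lincomb_fun !big_map ler_sum// => p _ /=.
  rewrite ler_wpM2r//; first exact: approximating_ge0.
  by have /andP[/ltW] := hq p.1.
rewrite /lincomb !big_map /= mulr_sumr -big_split/= ler_sum// => p _.
rewrite -[_ *: _]/(_ * _) -[p.1 *: _]/(_ * _) -mulrDl ler_wpM2r//.
by have /andP[_ /ltW] := hq p.1.
Qed.

End positive_extension.

(** * The vague topology *)

Section vague_topology.
Variables (G : topologicalZmodType) (R : realType).
Local Notation C := (R[i]^o).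
Import ComplexField.Normc.

Lemma cmeasure_cvg (F : set_system (cmeasure G R)) (nu : cmeasure G R) :
  Filter F -> (forall phi, (fun mu : cmeasure G R => mu phi) @ F --> nu phi) ->
  F --> nu.
Proof.
move=> FF h A [_ [[B oB <-] Bnu BA]].
have : {ptws, (set_val : cmeasure G R -> Cc G R -> C) @ F --> (set_val nu : Cc G R -> C)}.
  apply: (iffRL (@pointwise_cvgP (Cc G R) C (nbhs (set_val @ F)) (set_val nu) _)).
  by move=> phi; exact: h.
move=> /(_ B) FB.
have nB : nbhs (set_val nu : {ptws Cc G R -> C}) B by apply: open_nbhs_nbhs.
exact: (filterS BA (FB nB)).
Qed.

Lemma cmeasure_eval_continuous phi : continuous (fun mu : cmeasure G R => mu phi).
Proof.
move=> nu.
pose val : cmeasure G R -> Cc G R -> C := set_val.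
have h : {ptws, val @ nu --> val nu}.
  exact: (@initial_continuous _ {ptws Cc G R -> C} val nu).
have FF : Filter (val @ nu) := fmap_filter val (nbhs_filter nu).
exact: (iffLR (@pointwise_cvgP (Cc G R) C (val @ nu) (val nu) FF) h phi).
Qed.

Lemma cmeasure_act_continuous t : continuous (@cmeasure_act G R t).
Proof.
move=> nu.
apply: (cmeasure_cvg (fmap_filter _ (nbhs_filter nu))) => phi.
exact: (@cmeasure_eval_continuous (Cc_translate (- t) phi) nu).
Qed.

Lemma pmeasure_measurable_funP d (X : measurableType d) (Phi : X -> pmeasure G R) :
  (forall O : set (cmeasure G R), open O ->
    measurable (Phi @^-1` [set nu | O (set_val (nu : pmeasure_set G R))])) ->
  measurable_fun [set: X] Phi.
Proof.
move=> h _ _ [B mB <-]; rewrite !setTI.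
have : measurable_fun [set: X]
    ((fun w => cmeasure_of_pmeasure (Phi w)) : X -> Borel (cmeasure G R)).
  apply: (@measurability _ _ _ (Borel (cmeasure G R)) _ _ open erefl) => //=.
  move=> _ [V oV <-].
  by rewrite setTI; exact: h.
by move=> /(_ measurableT B mB); rewrite setTI.
Qed.

Lemma pmeasure_open_measurable (O : set (cmeasure G R)) : open O ->
  measurable [set nu : pmeasure G R | O (set_val (nu : pmeasure_set G R))].
Proof.
move=> oO; exists O; last by rewrite setTI.
exact: sub_gen_smallest.
Qed.

Lemma pmeasure_eval_measurable phi :
  measurable_fun [set: pmeasure G R] (pmeasure_eval phi : pmeasure G R -> Borel C).
Proof.
apply: (@measurability _ _ _ (Borel C) _ _ (@open C) erefl) => //= _ [V oV <-].
rewrite setTI.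
apply: (@pmeasure_open_measurable ((fun mu : cmeasure G R => mu phi) @^-1` V)).
by move/continuousP: (@cmeasure_eval_continuous phi); apply.
Qed.

Lemma pmeasure_act_measurable t : measurable_fun setT (@pmeasure_act G R t).
Proof.
apply: pmeasure_measurable_funP => V oV.
apply: (@pmeasure_open_measurable (@cmeasure_act G R t @^-1` V)).
by move/continuousP: (@cmeasure_act_continuous t); apply.
Qed.

(** For [t] in a compact neighborhood [U] of [t0] all translates are supported in the compact set
    [K = tsupp phi + U], where a neighborhood of 0 contains a sup-norm ball; compactness of [K]
    makes the pointwise continuity of [phi] uniform. It yields measurability of the action on
    measures in the group variable. *)
Lemma translate_continuous (phi : Cc G R) :
  locally_compact [set: G] -> continuous (fun t : G => Cc_translate t phi).
Proof.
move=> lG t0 A [W [aW bW] WA].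
have /Cc_predP [cphi kphi] := Cc_funP phi.
have [U nU cU] := locally_compact_nbhs lG t0.
set S := tsupp phi in kphi.
pose K := (fun p : G * G => p.1 + p.2) @` (S `*` U).
have cK : compact K.
  apply: continuous_compact; last exact: compact_setX.
  by apply: continuous_subspaceT => p; exact: add_continuous.
have tK t : U t -> tsupp (Cc_translate t phi) `<=` K.
  move=> Ut; apply: (subset_trans (@tsupp_translate _ _ _ t)).
  by move=> _ [x xphi <-]; exists (x, t) => //.
have [e e0 eW] := bW _ cK.
have close : \forall t \near t0,
    K `<=` [set x | normc (phi (x - t0) - phi (x - t)) < e].
  apply: (iffLR (compact_near_coveringP K)) => // x Kx.
  have cvg0 : (fun p : G * G => p.1 - p.2) @ (x, t0) --> x - t0.
    exact: (@tvs.sub_continuous G (x, t0)).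
  have e20 : 0 < e / 2 by rewrite divr_gt0.
  have nphi := normc_cvgC (nbhs_filter _) (cphi (x - t0)) e20.
  have n1 : \forall p \near (x, t0), normc (phi (x - t0) - phi (p.1 - p.2)) < e / 2.
    exact: (cvg0 _ nphi).
  have n2 : \forall y \near x, normc (phi (x - t0) - phi (y - t0)) < e / 2.
    exact: (@addr_continuousr G (- t0) x _ nphi).
  have n2' : \forall p \near (x, t0), normc (phi (x - t0) - phi (p.1 - t0)) < e / 2.
    exact: (@cvg_fst _ _ _ (nbhs t0) _ _ n2).
  apply: filterS2 n1 n2' => -[y t] /= h1 h2.
  rewrite (_ : phi (y - t0) - phi (y - t) =
    - (phi (x - t0) - phi (y - t0)) + (phi (x - t0) - phi (y - t))).
    apply: (le_lt_trans (le_normcD _ _)); rewrite normcN [ltRHS]splitr.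
    exact: ltrD.
  by rewrite opprB addrA subrK.
suff h : \forall t \near t0, W (Cc_translate t phi - Cc_translate t0 phi).
  by apply: filterS h => t; exact: WA.
have Ut0 := nbhs_singleton nU.
apply: filterS2 nU close => t Ut ct; apply: eW => [|x].
  rewrite -(setUid K).
  apply: (@subset_trans _ (tsupp (Cc_translate t phi) `|` tsupp (Cc_translate t0 phi))).
    rewrite /tsupp -closureU; apply: closureS => x /= h.
    have [f0|] := eqVneq (phi (x - t)) 0; last by left.
    right; apply: contra_neq h => g0.
    by rewrite -[LHS]/(phi (x - t) - phi (x - t0)) f0 g0 subr0.
  by apply: setUSS; apply: tK => //.
rewrite -[X in normc X]/(phi (x - t) - phi (x - t0)).
have [Kx|nKx] := pselect (K x).
  by rewrite -normcN opprB; apply: ltW; exact: ct.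
have phi0 s : U s -> phi (x - s) = 0.
  move=> Us; apply/eqP/negPn/negP => hs; apply: nKx; apply: (tK s Us).
  exact: subset_closure.
by rewrite !phi0 ?subr0 ?normc0 ?ltW//.
Qed.

End vague_topology.

(** * Positive measures and their values on the approximating family *)

Section positive_measures.
Variables (G : topologicalZmodType) (R : realType) (I : eqType) (e : I -> G -> R).
Hypothesis He : approximating e.
Local Notation C := (R[i]^o).
Local Notation E s := (lincomb (e : _ -> (G -> R^o)) s).
Implicit Type nu : pmeasure G R.
Import ComplexField.Normc.

Lemma family_real_Cc i : real_Cc (e i).
Proof. by split; [exact: approximating_continuous|exact: approximating_supp]. Qed.

Definition family_Cc i : Cc G R := Cc_real (family_real_Cc i).

Definition lincomb_Cc (s : seq (R * I)) : Cc G R :=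
  \sum_(p <- s) p.1%:C *: family_Cc p.2.

Lemma lincomb_CcE s x : lincomb_Cc s x = (E s x)%:C.
Proof.
rewrite /lincomb_Cc; elim: s => [|p s IH]; first by rewrite /lincomb !big_nil.
rewrite big_cons -[LHS]/(p.1%:C * (e p.2 x)%:C + lincomb_Cc s x) IH.
by rewrite /lincomb big_cons rmorphD/= -rmorphM.
Qed.

Lemma pmeasure_eval_linear nu : linear (fun phi : Cc G R => pmeasure_eval phi nu).
Proof. by have [] := cmeasureP (set_val (nu : pmeasure_set G R)). Qed.

Lemma pmeasure_eval_ge0 nu (phi : Cc G R) : (forall x, 0 <= phi x) ->
  0 <= pmeasure_eval phi nu.
Proof. by have /set_mem := valP (nu : pmeasure_set G R); apply. Qed.

Lemma pmeasure_eval0 nu : pmeasure_eval 0 nu = 0.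
Proof.
have := pmeasure_eval_linear nu (-1) 0 0.
by rewrite scaler0 addr0 scaleN1r addNr.
Qed.

Lemma pmeasure_evalD nu phi psi :
  pmeasure_eval (phi + psi) nu = pmeasure_eval phi nu + pmeasure_eval psi nu.
Proof. by have := pmeasure_eval_linear nu 1 phi psi; rewrite !scale1r. Qed.

Lemma pmeasure_evalZ nu a phi :
  pmeasure_eval (a *: phi) nu = a * pmeasure_eval phi nu.
Proof.
by have := pmeasure_eval_linear nu a phi 0; rewrite pmeasure_eval0 !addr0.
Qed.

Lemma pmeasure_evalB nu phi psi :
  pmeasure_eval (phi - psi) nu = pmeasure_eval phi nu - pmeasure_eval psi nu.
Proof. by rewrite -scaleN1r pmeasure_evalD pmeasure_evalZ mulN1r. Qed.

Definition family_value nu i : R := complex.Re (pmeasure_eval (family_Cc i) nu).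
Local Notation L nu s := (lincomb (family_value nu : _ -> R^o) s).

Lemma pmeasure_eval_family nu i :
  pmeasure_eval (family_Cc i) nu = (family_value nu i)%:C.
Proof.
rewrite RRe_real// ger0_real// pmeasure_eval_ge0// => x.
by rewrite -[X in 0 <= X]/((e i x)%:C) ler0c; exact: approximating_ge0.
Qed.

Lemma pmeasure_eval_lincomb nu s :
  pmeasure_eval (lincomb_Cc s) nu = (L nu s)%:C.
Proof.
rewrite /lincomb_Cc /lincomb; elim: s => [|p s IH].
  by rewrite !big_nil pmeasure_eval0.
rewrite !big_cons pmeasure_evalD pmeasure_evalZ pmeasure_eval_family IH.
by rewrite rmorphD/= -rmorphM.
Qed.

Lemma family_value_ge0 nu s : (forall x, 0 <= E s x) -> 0 <= L nu s.
Proof.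
move=> s0; rewrite -ler0c -pmeasure_eval_lincomb pmeasure_eval_ge0// => x.
by rewrite lincomb_CcE ler0c.
Qed.

Lemma pmeasure_eval_le nu s f (rf : real_Cc f) : (forall x, f x <= E s x) ->
  pmeasure_eval (Cc_real rf) nu <= (L nu s)%:C.
Proof.
move=> fs; rewrite -pmeasure_eval_lincomb -subr_ge0 -pmeasure_evalB.
rewrite pmeasure_eval_ge0// => x.
rewrite -[X in _ <= X]/(lincomb_Cc s x - (f x)%:C) lincomb_CcE -rmorphB/= ler0c.
by rewrite subr_ge0.
Qed.

Lemma pmeasure_eval_ge nu s f (rf : real_Cc f) : (forall x, E s x <= f x) ->
  (L nu s)%:C <= pmeasure_eval (Cc_real rf) nu.
Proof.
move=> fs; rewrite -pmeasure_eval_lincomb -subr_ge0 -pmeasure_evalB.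
rewrite pmeasure_eval_ge0// => x.
rewrite -[X in _ <= X]/((f x)%:C - lincomb_Cc s x) lincomb_CcE -rmorphB/= ler0c.
by rewrite subr_ge0.
Qed.

Lemma pmeasure_eval_dominated nu f (rf : real_Cc f) :
  dominated_value e (family_value nu) f (complex.Re (pmeasure_eval (Cc_real rf) nu)).
Proof.
move=> s; split=> hs.
  by have := pmeasure_eval_ge nu rf hs; rewrite lecE => /andP[].
by have := pmeasure_eval_le nu rf hs; rewrite lecE => /andP[].
Qed.

(** Comparable elements of [R[i]] have the same imaginary part, so one real upper bound makes the
    value real. *)
Lemma pmeasure_eval_real nu f (rf : real_Cc f) :
  pmeasure_eval (Cc_real rf) nu = (complex.Re (pmeasure_eval (Cc_real rf) nu))%:C.
Proof.
have [cf sf] := rf; have [s0 _ /(_ 1 ltr01)[s hs]] := approximating_dense He cf sf.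
have := @pmeasure_eval_le nu (s ++ s0) f rf.
rewrite lecE => /(_ _)/andP[|/eqP/= I0 _].
  by move=> x; rewrite lincomb_fun_cat; have := hs x; rewrite ler_distl => /andP[_]; lra.
by rewrite {1}[LHS]complexE_pair -I0.
Qed.

Lemma pmeasure_eval_ReIm nu phi : pmeasure_eval phi nu =
  complex.Re (pmeasure_eval (Cc_real (real_Cc_Re phi)) nu) +i*
  complex.Re (pmeasure_eval (Cc_real (real_Cc_Im phi)) nu).
Proof.
rewrite {1}(Cc_ReIm phi) pmeasure_evalD pmeasure_evalZ.
rewrite pmeasure_eval_real.
by rewrite [pmeasure_eval (Cc_real (real_Cc_Re _)) _]pmeasure_eval_real; simpc.
Qed.

Lemma pmeasure_ext nu nu' : (forall i, family_value nu i = family_value nu' i) ->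
  nu = nu'.
Proof.
move=> h; have hv : family_value nu = family_value nu' by exact/funext.
apply/val_inj/val_inj/funext => phi.
rewrite -[LHS]/(pmeasure_eval phi nu) -[RHS]/(pmeasure_eval phi nu').
rewrite [LHS]pmeasure_eval_ReIm [RHS]pmeasure_eval_ReIm.
have aux f (rf : real_Cc f) : complex.Re (pmeasure_eval (Cc_real rf) nu) =
    complex.Re (pmeasure_eval (Cc_real rf) nu').
  apply: (dominated_value_uniq He rf); first exact: pmeasure_eval_dominated.
  by rewrite hv; exact: pmeasure_eval_dominated.
by rewrite !aux.
Qed.

Section construction.
Variable n : I -> R.
Hypothesis n_ge0 : forall s, (forall x, 0 <= E s x) ->
  0 <= lincomb (n : _ -> R^o) s.
Local Notation ext := (extension e n).

Definition extension_functional (phi : Cc G R) : C :=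
  ext (fun x => complex.Re (phi x)) +i* ext (fun x => complex.Im (phi x)).

Lemma extension_functional_linear : linear extension_functional.
Proof.
move=> c phi psi; rewrite /extension_functional.
have rR := real_Cc_Re; have rI := real_Cc_Im.
have -> : (fun x => complex.Re ((c *: phi + psi) x)) =
    (fun x => complex.Re c * complex.Re (phi x) +
      ((- complex.Im c) * complex.Im (phi x) + complex.Re (psi x))).
  apply/funext => x; rewrite -[(c *: phi + psi) x]/(c * phi x + psi x).
  by case: c (phi x) (psi x) => [a b] [a1 b1] [a2 b2] /=; ring.
have -> : (fun x => complex.Im ((c *: phi + psi) x)) =
    (fun x => complex.Re c * complex.Im (phi x) +
      (complex.Im c * complex.Re (phi x) + complex.Im (psi x))).
  apply/funext => x; rewrite -[(c *: phi + psi) x]/(c * phi x + psi x).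
  by case: c (phi x) (psi x) => [a b] [a1 b1] [a2 b2] /=; ring.
rewrite !(extension_lin He n_ge0)//; try exact: real_Cc_lin.
rewrite -[_ *: _]/(c * _); case: c => a b /=; simpc.
by congr (_ +i* _); ring.
Qed.

Lemma extension_functional0 : extension_functional 0 = 0.
Proof.
have := extension_functional_linear (-1) 0 0.
by rewrite scaler0 addr0 scaleN1r addNr.
Qed.

Lemma extension_functional_ge0 (phi : Cc G R) : (forall x, 0 <= phi x) ->
  0 <= extension_functional phi.
Proof.
move=> phi0; rewrite lecE /=; apply/andP; split; last first.
  apply: (extension_ge0 He n_ge0); first exact: real_Cc_Re.
  by move=> x; have := phi0 x; rewrite lecE => /andP[].
rewrite (_ : (fun x => complex.Im (phi x)) = (fun=> 0)).
  by rewrite (extension0 He n_ge0).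
by apply/funext => x; have := phi0 x; rewrite lecE => /andP[/eqP].
Qed.

(** The sets where the modulus of the functional is at most a constant are absolutely convex, so
    only their traces on the C_c(K) matter. A function supported in [K] and bounded by [d] is
    dominated by [d] times a combination that is at least 1 on [K], and positivity bounds its
    value. *)
Lemma extension_functional_continuous : continuous extension_functional.
Proof.
move=> phi; apply: (cvgC_normc (nbhs_filter phi)) => eps eps0.
exists [set psi | normc (extension_functional psi) <= eps / 2]; last first.
  move=> psi; rewrite /mkset => h.
  have -> : extension_functional phi - extension_functional psi =
      extension_functional (-1 *: psi + phi).
    by rewrite extension_functional_linear addrC scaleN1r.
  rewrite (_ : -1 *: psi + phi = -1 *: (psi - phi) + 0); last first.
    by rewrite addr0 !scaleN1r opprB addrC.
  rewrite extension_functional_linear.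
  rewrite extension_functional0 addr0 scaleN1r normcN (le_lt_trans h)//.
  by rewrite ltr_pdivrMr// ltr_pMr// ltr1n.
split=> [a b f g ab|K cK].
  rewrite /mkset => hf hg.
  have -> : extension_functional (a *: f + b *: g) =
      a * extension_functional f + b * extension_functional g.
    have := extension_functional_linear b g 0; rewrite addr0 => hb.
    by rewrite extension_functional_linear hb extension_functional0 addr0.
  apply: (le_trans (le_normcD _ _)); rewrite !normcM.
  have ab' : normc a + normc b <= 1.
    by move: ab; rewrite !normcEC -rmorphD/= -(rmorph1 (real_complex R)) lecR.
  apply: (@le_trans _ _ (normc a * (eps / 2) + normc b * (eps / 2))).
    by rewrite lerD// ler_wpM2l ?normc_ge0.
  by rewrite -mulrDl ler_piMl// divr_ge0// ltW.
have [s s0 sK] := approximating_dominate He cK.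
set l := lincomb (n : _ -> R^o) s.
have l0 : 0 <= l by exact: n_ge0.
(* Real and imaginary part contribute at most [eps / 4] each; [l + 1] replaces [l], which may be
   0. *)
pose d := eps / 4 / (l + 1).
have l1 : 0 < l + 1 by rewrite ltr_wpDl.
have d0 : 0 < d by rewrite !divr_gt0.
exists d => // f fK fd.
have bound x : normc (f x) <= d * E s x.
  have [Kx|nKx] := pselect (K x).
    by rewrite (le_trans (fd x))// ler_peMr ?(ltW d0)//; exact: nbhs_singleton (sK x Kx).
  have -> : f x = 0.
    by apply/eqP/negPn/negP => fx; apply: nKx; apply: fK; exact: subset_closure.
  by rewrite normc0 mulr_ge0 ?(ltW d0)//; exact: s0.
have dl : d * l <= eps / 4.
  rewrite /d -mulrA ler_piMr ?divr_ge0 ?(ltW eps0)//.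
  by rewrite ler_pdivrMl// mulr1 lerDl.
rewrite /mkset; apply: (le_trans (normc_le_ReIm _)) => /=.
have b1 : `|ext (fun x => complex.Re (f x))| <= d * l.
  apply: (extension_bound He n_ge0); first exact: real_Cc_Re.
  by move=> x; apply: le_trans (bound x); exact: normr_Re_le.
have b2 : `|ext (fun x => complex.Im (f x))| <= d * l.
  apply: (extension_bound He n_ge0); first exact: real_Cc_Im.
  by move=> x; apply: le_trans (bound x); exact: normr_Im_le.
by lra.
Qed.

Lemma pmeasure_exists : exists nu, family_value nu = n.
Proof.
pose mu := MkCmeasure (conj extension_functional_linear extension_functional_continuous).
have pmu : positive_functional mu by exact: extension_functional_ge0.
exists (exist _ mu (mem_set pmu)); apply/funext => i.
by rewrite /family_value /= (extension_family He n_ge0).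
Qed.

End construction.

End positive_measures.

(** * A countable base for the vague topology on positive measures *)

Section vague_topology_on_positive_measures.
Variables (G : topologicalZmodType) (R : realType) (I : eqType) (e : I -> G -> R).
Hypothesis He : approximating e.
Local Notation C := (R[i]^o).
Local Notation E s := (lincomb (e : _ -> (G -> R^o)) s).
Local Notation value := (family_value He).
Local Notation L nu s := (lincomb (value nu : _ -> R^o) s).
Implicit Type nu : pmeasure G R.
Import ComplexField.Normc.

Section convergence.
Variables (F : set_system (pmeasure G R)) (FF : Filter F) (nu0 : pmeasure G R).
Hypothesis Fvalue : forall i, (fun nu => value nu i) @ F --> value nu0 i.

Lemma cvg_lincomb_value s : (fun nu => L nu s : R) @ F --> (L nu0 s : R).
Proof.
elim: s => [|p s IH].
  rewrite /lincomb big_nil (_ : (fun nu => _) = cst 0); first exact: cvg_cst.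
  by apply/funext => nu; rewrite big_nil.
rewrite (_ : (fun nu => _) = (fun nu => p.1 * value nu p.2 + L nu s)).
  rewrite {2}/lincomb big_cons; apply: cvgD => //.
  by apply: cvgM; [exact: cvg_cst|exact: Fvalue].
by apply/funext => nu; rewrite {1}/lincomb big_cons.
Qed.

Lemma cvg_eval_real f (rf : real_Cc f) :
  (fun nu => complex.Re (pmeasure_eval (Cc_real rf) nu)) @ F -->
  complex.Re (pmeasure_eval (Cc_real rf) nu0).
Proof.
have [cf sf] := rf; have [s0 s00 hs0] := approximating_dense He cf sf.
apply/cvgrPdist_lt => eps eps0.
have L00 : 0 <= (L nu0 s0 : R) by exact: family_value_ge0.
(* Eventually [L nu s0 < L nu0 s0 + 1], so the same [d] keeps the error of replacing [f] by [E s]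
   below [eps / 3] at [nu0] and at [nu]. *)
pose d := eps / 3 / (L nu0 s0 + 1).
have l1 : 0 < (L nu0 s0 : R) + 1 by rewrite ltr_wpDl.
have d0 : 0 < d by rewrite !divr_gt0.
have [s hs] := hs0 d d0.
have dl : d * (L nu0 s0 + 1) = eps / 3 by rewrite /d divfK// gt_eqF.
have /cvgrPdist_lt/(_ 1 ltr01) h1 := @cvg_lincomb_value s0.
have e30 : 0 < eps / 3 by rewrite divr_gt0.
have /cvgrPdist_lt/(_ _ e30) h2 := @cvg_lincomb_value s.
apply: filterS2 h1 h2 => nu; rewrite !ltr_distl => /andP[a1 a2] /andP[a3 a4].
have := dominated_value_dist (pmeasure_eval_dominated He nu rf) hs.
have := dominated_value_dist (pmeasure_eval_dominated He nu0 rf) hs.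
rewrite !ler_distl => /andP[b1 b2] /andP[b3 b4].
have c1 : d * L nu0 s0 < eps / 3 by rewrite -dl ltr_pM2l// ltrDl.
have c2 : d * L nu s0 < eps / 3 by rewrite -dl ltr_pM2l//; lra.
by apply/andP; split; lra.
Qed.

Lemma cvg_pmeasure_eval phi : pmeasure_eval phi @ F --> pmeasure_eval phi nu0.
Proof.
apply: (cvgC_normc FF) => eps eps0.
have e20 : 0 < eps / 2 by rewrite divr_gt0.
have /cvgrPdist_lt/(_ _ e20) h1 := @cvg_eval_real _ (real_Cc_Re phi).
have /cvgrPdist_lt/(_ _ e20) h2 := @cvg_eval_real _ (real_Cc_Im phi).
apply: filterS2 h1 h2 => nu h1 h2.
apply: (le_lt_trans (normc_le_ReIm _)).
rewrite !(pmeasure_eval_ReIm He _ phi) ReB ImB /= [ltRHS]splitr.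
exact: ltrD.
Qed.

Lemma cvg_cmeasure_of_pmeasure :
  (fun nu => set_val (nu : pmeasure_set G R) : cmeasure G R) @ F -->
  (set_val (nu0 : pmeasure_set G R) : cmeasure G R).
Proof.
by apply: (cmeasure_cvg (fmap_filter _ FF)) => phi; exact: cvg_pmeasure_eval.
Qed.

End convergence.

Definition value_box (c : seq (I * rat)) (k : nat) : set (pmeasure G R) :=
  [set nu | forall p, p \in c -> `|value nu p.1 - ratr p.2| < k.+1%:R^-1].

Lemma value_box_open (O : set (cmeasure G R)) nu0 : open O ->
  O (set_val (nu0 : pmeasure_set G R)) ->
  exists c k, value_box c k nu0 /\
    value_box c k `<=` [set nu | O (set_val (nu : pmeasure_set G R))].
Proof.
move=> oO Onu0.
(* Boxes centered exactly at [nu0] form a filter along which all coordinates converge; hence it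
   converges vaguely and one of its boxes lies in [O]. Rational centers come afterwards. *)
pose B (p : seq I * nat) :=
  [set nu | forall i, i \in p.1 -> `|value nu i - value nu0 i| < p.2.+1%:R^-1].
pose F := filter_from [set: seq I * nat] B.
have inv_le (k l : nat) : (k <= l)%N -> l.+1%:R^-1 <= k.+1%:R^-1 :> R.
  by move=> kl; rewrite lef_pV2 ?posrE// ler_nat.
have FF : Filter F.
  apply: filter_from_filter; first by exists ([::], 0%N).
  move=> [s k] [t l] _ _; exists (s ++ t, maxn k l) => // nu /= h; split=> i /= si.
    have := h i; rewrite mem_cat si => /(_ isT)/lt_le_trans; apply.
    by apply: inv_le; rewrite leq_maxl.
  have := h i; rewrite mem_cat si orbT => /(_ isT)/lt_le_trans; apply.
  by apply: inv_le; rewrite leq_maxr.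
have Fvalue i : (fun nu => value nu i) @ F --> value nu0 i.
  apply/cvgrPdist_lt => eps eps0.
  have [k _ hk] := near_infty_natSinv_lt (PosNum eps0).
  exists ([:: i], k) => // nu /= /(_ i); rewrite mem_head => /(_ isT).
  by rewrite distrC => /lt_trans; apply; exact: (hk k (leqnn _)).
have nO : nbhs (set_val (nu0 : pmeasure_set G R)) O by apply: open_nbhs_nbhs.
have [[s k] _ hB] := cvg_cmeasure_of_pmeasure FF Fvalue nO.
(* Then [j + 1 = 2 (k + 1)]: the radius is halved, which leaves room for moving the center to a
   rational point. *)
pose j := (k.*2).+1.
have jE : j.+1%:R^-1 = k.+1%:R^-1 / 2 :> R.
  by rewrite -invfM -natrM muln2.
have j0 : 0 < j.+1%:R^-1 :> R by rewrite invr_gt0.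
have /choice[q hq] (i : I) : exists q : rat, `|value nu0 i - ratr q| < j.+1%:R^-1.
  have /rat_in_itvoo[q] : value nu0 i - j.+1%:R^-1 < value nu0 i + j.+1%:R^-1.
    by rewrite ltrD2l gtrN.
  rewrite in_itv => /andP[/= h1 h2]; exists q; rewrite ltr_distl.
  by rewrite ltrBlDr h2 -ltrBlDr h1.
exists [seq (i, q i) | i <- s], j; split=> [_ /mapP[i si ->]//|nu hnu].
apply: hB => i /= si; have := hnu _ (map_f (fun i => (i, q i)) si) => /= h1.
have h2 := hq i; rewrite jE in h1 h2.
rewrite -(subrKA (ratr (q i))) (le_lt_trans (ler_normD _ _))//.
by rewrite [ltRHS]splitr ltrD// distrC.
Qed.

End vague_topology_on_positive_measures.

Lemma measurable_fun_pmeasure (G : topologicalZmodType) (R : realType)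
    (I : countType) (e : I -> G -> R) (He : approximating e)
    d (X : measurableType d) (Phi : X -> pmeasure G R) :
  (forall i, measurable_fun [set: X] (fun w => family_value He (Phi w) i)) ->
  measurable_fun [set: X] Phi.
Proof.
move=> mv; apply: pmeasure_measurable_funP => O oO.
pose OO : set (pmeasure G R) := [set nu | O (set_val (nu : pmeasure_set G R))].
pose D := [set p : seq (I * rat) * nat | value_box He p.1 p.2 `<=` OO].
rewrite (_ : _ @^-1` _ = \bigcup_(p in D) (Phi @^-1` value_box He p.1 p.2)).
  rewrite bigcup_mkcond; apply: countable_bigcupT_measurable => [|[c k]].
    exact: countableP.
  case: ifP => _ //=.
  rewrite (_ : _ @^-1` _ = \big[setI/setT]_(p <- c)
      ((fun w => family_value He (Phi w) p.1) @^-1` ball (ratr p.2 : R) k.+1%:R^-1)).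
    apply: bigsetI_measurable => p _.
    rewrite -[X in measurable X]setTI; apply: mv => //.
    rewrite ball_itv; exact: measurable_itv.
  rewrite -bigcap_seq; apply/seteqP; split => w /= h p pc.
    by rewrite /ball /= distrC; exact: h.
  by have := h p pc; rewrite /ball /= distrC.
apply/seteqP; split => w /=.
  by move=> /(value_box_open He oO)[c [k [h1 h2]]]; exists (c, k).
by move=> [[c k] h1 h2]; exact: h1.
Qed.

(** * Complex-valued measurable and square integrable functions *)

Section complex_measurable.
Context d (X : measurableType d) (R : realType).
Local Notation C := (R[i]^o).
Implicit Types f g : X -> C.
Import ComplexField.Normc.

Definition Cmeasurable f := measurable_fun [set: X] (f : X -> Borel C).

Lemma measurable_comp_continuousR f (h : C -> R) : continuous h -> Cmeasurable f ->
  measurable_fun [set: X] (fun x => h (f x)).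
Proof.
move=> /continuousP ch mf.
apply: (measurability _ (RGenOpens.measurableE R)) => _ [_ [a [b ->] <-]].
have := mf measurableT (h @^-1` `]a, b[%classic); rewrite !setTI; apply.
by apply: sub_gen_smallest; apply: ch; exact: interval_open.
Qed.

Lemma Cmeasurable_Re f : Cmeasurable f -> measurable_fun setT (fun x => complex.Re (f x)).
Proof. exact: (measurable_comp_continuousR (@Re_continuous R)). Qed.

Lemma Cmeasurable_Im f : Cmeasurable f -> measurable_fun setT (fun x => complex.Im (f x)).
Proof. exact: (measurable_comp_continuousR (@Im_continuous R)). Qed.

Lemma Cmeasurable_comp_continuous f (h : C -> C) : continuous h -> Cmeasurable f ->
  Cmeasurable (fun x => h (f x)).
Proof.
move=> /continuousP ch mf.
apply: (@measurability _ _ _ (Borel C) _ _ (@open C) erefl) => //= _ [V oV <-].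
have := mf measurableT (h @^-1` V); rewrite !setTI; apply.
by apply: sub_gen_smallest; exact: ch.
Qed.

Lemma CmeasurableP f : measurable_fun setT (fun x => complex.Re (f x)) ->
  measurable_fun setT (fun x => complex.Im (f x)) -> Cmeasurable f.
Proof.
move=> mR mI.
apply: (@measurability _ _ _ (Borel C) _ _ (@open C) erefl) => //= _ [V oV <-].
pose B (p : rat * rat * nat) := [set z : C |
  `|complex.Re z - ratr p.1.1| < p.2.+1%:R^-1 /\
  `|complex.Im z - ratr p.1.2| < p.2.+1%:R^-1].
pose D := [set p | B p `<=` V].
have -> : setT `&` f @^-1` V = \bigcup_(p in D) (f @^-1` B p).
  rewrite setTI; apply/seteqP; split => x /=; last by move=> [p pD /pD].
  move=> Vfx.
  have [e e0 eV] : exists2 e : R, 0 < e & forall z : C, normc (f x - z) < e -> V z.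
    have : nbhs (f x) V by apply: open_nbhs_nbhs.
    move=> /(@nbhs_ballP _ C)[e /= e0 eV]; exists (complex.Re e).
      by move: e0; rewrite ltcE => /andP[].
    move=> z hz; apply: eV; rewrite /ball /= normcEC.
    by move: e0; rewrite !ltcE /= => /andP[-> _].
  (* Both [z] and [f x] are coordinatewise within [e / 4] of the rational center, so their
     coordinates differ by less than [e / 2] and their distance is less than [e]. *)
  have e40 : 0 < e / 4 by rewrite divr_gt0.
  have [k _ /(_ k (leqnn _)) /= hk] := near_infty_natSinv_lt (PosNum e40).
  have k0 : 0 < k.+1%:R^-1 :> R by rewrite invr_gt0.
  have /choice[q hq] (r : R) : exists q : rat, `|r - ratr q| < k.+1%:R^-1.
    have /rat_in_itvoo[q] : r - k.+1%:R^-1 < r + k.+1%:R^-1 by rewrite ltrD2l gtrN.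
    rewrite in_itv => /andP[/= h1 h2]; exists q; rewrite ltr_distl.
    by rewrite ltrBlDr h2 -ltrBlDr h1.
  exists (q (complex.Re (f x)), q (complex.Im (f x)), k) => /=; last by split; exact: hq.
  move=> z /= [z1 z2]; apply: eV; apply: (le_lt_trans (normc_le_ReIm _)).
  rewrite ReB ImB.
  have := hq (complex.Re (f x)); have := hq (complex.Im (f x)).
  move: z1 z2; move: (k.+1%:R^-1) hk => K hk.
  rewrite !ltr_distl => /andP[? ?] /andP[? ?] /andP[? ?] /andP[? ?].
  have : `|complex.Re (f x) - complex.Re z| < e / 2.
    by rewrite ltr_distl; apply/andP; split; lra.
  have : `|complex.Im (f x) - complex.Im z| < e / 2.
    by rewrite ltr_distl; apply/andP; split; lra.
  by lra.
rewrite bigcup_mkcond; apply: countable_bigcupT_measurable => [|p].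
  exact: countableP.
case: ifP => _ //=.
rewrite (_ : f @^-1` B p =
  ((fun x => complex.Re (f x)) @^-1` ball (ratr p.1.1 : R) p.2.+1%:R^-1) `&`
  ((fun x => complex.Im (f x)) @^-1` ball (ratr p.1.2 : R) p.2.+1%:R^-1)).
  apply: measurableI; rewrite -[X in measurable X]setTI;
    [apply: mR|apply: mI] => //; rewrite ball_itv; exact: measurable_itv.
by apply/seteqP; split=> x /= [h1 h2]; split; rewrite /ball/= distrC.
Qed.

Lemma Cmeasurable_lin a f g : Cmeasurable f -> Cmeasurable g ->
  Cmeasurable (a *: f + g).
Proof.
move=> mf mg; have := Cmeasurable_Re mf; have := Cmeasurable_Re mg.
have := Cmeasurable_Im mf; have := Cmeasurable_Im mg => h1 h2 h3 h4.
apply: CmeasurableP.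
  rewrite (_ : (fun x => _) = (fun x => complex.Re a * complex.Re (f x)
     - complex.Im a * complex.Im (f x) + complex.Re (g x))).
    by apply: measurable_funD => //; apply: measurable_funB => //; apply: measurable_funM.
  apply/funext => x; rewrite -[(a *: f + g) x]/(a * f x + g x).
  by case: a (f x) (g x) => [? ?] [? ?] [? ?].
rewrite (_ : (fun x => _) = (fun x => complex.Re a * complex.Im (f x)
   + complex.Im a * complex.Re (f x) + complex.Im (g x))).
  by apply: measurable_funD => //; apply: measurable_funD => //; apply: measurable_funM.
apply/funext => x; rewrite -[(a *: f + g) x]/(a * f x + g x).
by case: a (f x) (g x) => [? ?] [? ?] [? ?].
Qed.

Lemma Cmeasurable_cst (z : C) : Cmeasurable (cst z).
Proof. exact: measurable_cst. Qed.

Lemma CmeasurableM f g : Cmeasurable f -> Cmeasurable g ->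
  Cmeasurable (fun x => (f x * g x : R[i])).
Proof.
move=> mf mg; have := Cmeasurable_Re mf; have := Cmeasurable_Re mg.
have := Cmeasurable_Im mf; have := Cmeasurable_Im mg => h1 h2 h3 h4.
apply: CmeasurableP.
  rewrite (_ : (fun x => _) = (fun x => complex.Re (f x) * complex.Re (g x)
     - complex.Im (f x) * complex.Im (g x))).
    by apply: measurable_funB => //; apply: measurable_funM.
  by apply/funext => x; case: (f x) (g x) => [? ?] [? ?].
rewrite (_ : (fun x => _) = (fun x => complex.Re (f x) * complex.Im (g x)
     + complex.Im (f x) * complex.Re (g x))).
  by apply: measurable_funD => //; apply: measurable_funM.
by apply/funext => x; case: (f x) (g x) => [? ?] [? ?].
Qed.

Lemma normc_continuous : continuous (fun z : C => normc z : R).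
Proof.
move=> z; apply/(@cvgrPdist_lt _ _ _ _ (nbhs_filter z)) => e e0.
have zz : (id : C -> C) @ z --> z by exact: cvg_id.
have := normc_cvgC (nbhs_filter z) zz e0; apply: filterS => t.
apply: le_lt_trans; rewrite ler_norml; apply/andP; split.
  rewrite lerBrDl lerBlDr -[normc (z - t)]normcN opprB addrC.
  by rewrite -{1}(subrK z t) le_normcD.
by rewrite lerBlDr -{1}(subrK t z) le_normcD.
Qed.

Lemma Cmeasurable_normc f : Cmeasurable f -> measurable_fun setT (fun x => normc (f x)).
Proof. exact: (measurable_comp_continuousR normc_continuous). Qed.

Lemma Cmeasurable_eq f g : Cmeasurable f -> Cmeasurable g ->
  measurable [set x | f x = g x].
Proof.
move=> mf mg.
have -> : [set x | f x = g x] =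
    [set x | complex.Re (f x) == complex.Re (g x)] `&`
    [set x | complex.Im (f x) == complex.Im (g x)].
  apply/seteqP; split => x /=; first by move=> ->; rewrite !eqxx.
  by move=> [/eqP h1 /eqP h2]; case: (f x) (g x) h1 h2 => [? ?] [? ?] /= -> ->.
have := measurable_fun_eqr (Cmeasurable_Re mf) (Cmeasurable_Re mg).
have := measurable_fun_eqr (Cmeasurable_Im mf) (Cmeasurable_Im mg).
move=> /(_ measurableT [set true] I) + /(_ measurableT [set true] I); rewrite !setTI.
move=> h1 h2; exact: measurableI h2 h1.
Qed.

End complex_measurable.

(** * Square integrable and essentially bounded functions *)

Section L2.
Context d (X : measurableType d) (R : realType) (m : probability X R).
Local Notation C := (R[i]^o).
Implicit Types f g : X -> C.
Import ComplexField.Normc.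

Lemma Lp_norm2E f :
  Lp_norm m 2%:E f = ((\int[m]_x (normc (f x) ^+ 2)%:E) `^ 2^-1)%E.
Proof.
rewrite /Lp_norm unlock; congr (poweR _ _); apply: eq_integral => x _.
by rewrite /= ger0_norm ?normc_ge0// powR_mulrn ?normc_ge0.
Qed.

Lemma measurable_sqnormc f : Cmeasurable f ->
  measurable_fun setT (fun x => (normc (f x) ^+ 2)%:E).
Proof.
move=> mf; apply/measurable_EFinP; apply: measurable_funX.
exact: Cmeasurable_normc.
Qed.

Lemma Lp2P f : Lp m 2%:E f <->
  Cmeasurable f /\ (\int[m]_x (normc (f x) ^+ 2)%:E < +oo)%E.
Proof.
have I0 : (0 <= \int[m]_x (normc (f x) ^+ 2)%:E)%E.
  by apply: integral_ge0 => x _; rewrite lee_fin sqr_ge0.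
rewrite /Lp /= Lp_norm2E; split=> -[mf h]; split => //.
  by apply: lty_poweRy h; rewrite invr_neq0// pnatr_eq0.
by rewrite poweR_lty.
Qed.

Lemma Lp_norm2_lt f (e : R) : 0 < e -> (Lp_norm m 2%:E f < e%:E)%E ->
  (\int[m]_x (normc (f x) ^+ 2)%:E < (e ^+ 2)%:E)%E.
Proof.
move=> e0; rewrite Lp_norm2E.
have I0 : (0 <= \int[m]_x (normc (f x) ^+ 2)%:E)%E.
  by apply: integral_ge0 => x _; rewrite lee_fin sqr_ge0.
move: I0; case: (\int[m]_x _)%E => [r||]//; last by rewrite poweRyr ?invr_neq0 ?pnatr_eq0.
rewrite !lee_fin poweR_EFin !lte_fin => r0 h.
rewrite -(sqr_sqrtr r0) -[in ltLHS](powR12_sqrt r0) ltrXn2r ?powR_ge0//. 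
Qed.

Lemma eq_ae_Lp_norm2 f g : Cmeasurable f -> Cmeasurable g ->
  f = g %[ae m] -> Lp_norm m 2%:E f = Lp_norm m 2%:E g.
Proof.
move=> mf mg fg; rewrite !Lp_norm2E; congr (poweR _ _).
apply: ae_eq_integral => //; try exact: measurable_sqnormc.
by apply: filterS fg => x /[apply] ->.
Qed.

Lemma eq_ae_Lp2 f g : Cmeasurable g -> f = g %[ae m] -> Lp m 2%:E f -> Lp m 2%:E g.
Proof.
move=> mg fg [mf h]; split => //.
by rewrite -(eq_ae_Lp_norm2 mf mg fg).
Qed.

Lemma Lp2_lin (a : R[i]) f g : Lp m 2%:E f -> Lp m 2%:E g -> Lp m 2%:E (a *: f + g).
Proof.
move=> /Lp2P[mf If] /Lp2P[mg Ig]; apply/Lp2P; split; first exact: Cmeasurable_lin.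
(* From [(u + v)^2 <= 2 u^2 + 2 v^2]. *)
pose c := 2 * normc a ^+ 2.
have c0 : 0 <= c by rewrite /c mulr_ge0 ?sqr_ge0.
apply: (@le_lt_trans _ _ (\int[m]_x
    ((c%:E * (normc (f x) ^+ 2)%:E + 2%:E * (normc (g x) ^+ 2)%:E)%E))%E).
  apply: ge0_le_integral => //.
  - by move=> x _; rewrite lee_fin sqr_ge0.
  - by apply: measurable_sqnormc; exact: Cmeasurable_lin.
  - apply: emeasurable_funD; apply: measurable_funeM; exact: measurable_sqnormc.
  - move=> x _; rewrite -!EFinM -EFinD lee_fin.
    have h : normc ((a *: f + g) x) <= normc a * normc (f x) + normc (g x).
      rewrite -[(a *: f + g) x]/(a * f x + g x).
      by rewrite (le_trans (le_normcD _ _))// normcM.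
    apply: (@le_trans _ _ ((normc a * normc (f x) + normc (g x)) ^+ 2)).
      by apply: lerXn2r => //; rewrite nnegrE ?addr_ge0 ?mulr_ge0 ?normc_ge0.
    rewrite /c; have := sqr_ge0 (normc a * normc (f x) - normc (g x)).
    by move: (normc a) (normc (f x)) (normc (g x)) => p q r; rewrite !expr2; nra.
rewrite ge0_integralD//.
- rewrite !ge0_integralZl//; try exact: measurable_sqnormc.
  + by apply: lte_add_pinfty; apply: lte_mul_pinfty => //; rewrite lee_fin.
  + by move=> x _; rewrite lee_fin sqr_ge0.
  + by move=> x _; rewrite lee_fin sqr_ge0.
- by move=> x _; rewrite mule_ge0// lee_fin sqr_ge0.
- by apply: measurable_funeM; exact: measurable_sqnormc.
- by move=> x _; rewrite mule_ge0// lee_fin sqr_ge0.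
- by apply: measurable_funeM; exact: measurable_sqnormc.
Qed.

Lemma ae_bounded_Lp2 f (M : R) : Cmeasurable f ->
  (\forall x \ae m, normc (f x) <= M) -> Lp m 2%:E f.
Proof.
move=> mf fM; apply/Lp2P; split => //.
apply: (@le_lt_trans _ _ (\int[m]_x (cst (M ^+ 2)%:E x))%E).
  apply: ae_ge0_le_integral => //.
  - by move=> x _; rewrite lee_fin sqr_ge0.
  - exact: measurable_sqnormc.
  - by move=> x _; rewrite lee_fin sqr_ge0.
  - apply: filterS fM => x fM _; rewrite lee_fin lerXn2r ?nnegrE ?normc_ge0//.
    exact: le_trans (normc_ge0 _) fM.
rewrite integral_cst// [X in (_ * X)%E](_ : _ = 1%E); last exact: probability_setT.
by rewrite mule1 ltry.
Qed.

Lemma Linf_ae_bounded f : Lp m +oo%E f ->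
  exists M, \forall x \ae m, normc (f x) <= M.
Proof.
(* The norm with exponent [+oo] is the essential supremum only on a space of positive measure. *)
have m1 : (0 < m [set: X])%E by rewrite [m _]probability_setT.
move=> [mf]; have := Lnorm_ge0 m +oo%E (fun x => (normc (f x))%:E).
rewrite -/(Lp_norm m +oo%E f) {1 2}/Lp_norm unlock m1.
set s := ess_sup _ _; have := ess_sup_ge m (abse \o (fun x => (normc (f x))%:E)).
rewrite -/s; case: s => [r||]// h _ _; exists r; apply: filterS h => x /=.
by rewrite lee_fin ger0_norm ?normc_ge0.
Qed.

Lemma Linf_Lp2 f : Lp m +oo%E f -> Lp m 2%:E f.
Proof.
move=> Lf; have [M hM] := Linf_ae_bounded Lf.
by case: Lf => mf _; exact: ae_bounded_Lp2 hM.
Qed.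

Lemma Linf_mul_Lp2 f g : Lp m +oo%E f -> Lp m +oo%E g ->
  Lp m 2%:E (fun x => (f x * g x : R[i])).
Proof.
move=> Lf Lg; have [M hM] := Linf_ae_bounded Lf; have [M' hM'] := Linf_ae_bounded Lg.
case: Lf Lg => mf _ [mg _]; apply: (@ae_bounded_Lp2 _ (M * M')).
  exact: CmeasurableM.
by apply: filterS2 hM hM' => x h h'; rewrite normcM ler_pM ?normc_ge0.
Qed.

End L2.

(** * Factor maps *)

Section pullback.
Context d d' (X : measurableType d) (X' : measurableType d') (R : realType).
Variables (m : probability X R) (m' : probability X' R) (Phi : X -> X').
Hypothesis mPhi : measurable_fun [set: X] Phi.
Hypothesis m'E : forall A, measurable A -> m' A = m (Phi @^-1` A).
Local Notation C := (R[i]^o).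
Implicit Types (f : X -> C) (g : X' -> C).
Import ComplexField.Normc.

Lemma ae_pullback (P : set X') : (\forall y \ae m', P y) -> \forall x \ae m, P (Phi x).
Proof.
move=> [A [mA A0 PA]]; exists (Phi @^-1` A); split.
- by rewrite -[X in measurable X]setTI; exact: mPhi.
- by rewrite -m'E.
- by move=> x; apply: PA.
Qed.

(** The exceptional set in [X] need not be a preimage under [Phi], so the complement of [P] itself
    serves as the null set; this is where [P] has to be measurable. *)
Lemma ae_pushforward (P : set X') : measurable P ->
  (\forall x \ae m, P (Phi x)) -> \forall y \ae m', P y.
Proof.
move=> mP [A [mA A0 PA]]; exists (~` P); split => //; first exact: measurableC.
rewrite m'E; last exact: measurableC.
apply/eqP; rewrite -measure_le0 -A0; apply: le_measure; rewrite ?inE//.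
by rewrite -[X in measurable X]setTI; apply: mPhi => //; exact: measurableC.
Qed.

Lemma ae_eq_pushforward g1 g2 : Cmeasurable g1 -> Cmeasurable g2 ->
  g1 \o Phi = g2 \o Phi %[ae m] -> g1 = g2 %[ae m'].
Proof.
move=> m1 m2 h.
have : \forall y \ae m', [set y | g1 y = g2 y] y.
  apply: ae_pushforward; first exact: Cmeasurable_eq.
  by apply: filterS h => x /(_ I).
by apply: filterS => y /= -> _.
Qed.

Lemma ae_eq_pullback g1 g2 : g1 = g2 %[ae m'] -> g1 \o Phi = g2 \o Phi %[ae m].
Proof. by move=> /ae_pullback; apply: filterS => x /(_ I) h _. Qed.

Lemma Cmeasurable_pullback g : Cmeasurable g -> Cmeasurable (g \o Phi).
Proof. by move=> mg; exact: (measurableT_comp mg mPhi). Qed.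

Lemma ge0_integral_pullback (h : X' -> \bar R) : measurable_fun setT h ->
  (forall y, 0 <= h y)%E -> (\int[m']_y h y = \int[m]_x h (Phi x))%E.
Proof.
move=> mh h0.
have := @ge0_integral_pushforward _ _ _ _ _ _ mPhi m setT h measurableT mh.
rewrite preimage_setT => <- //.
by apply: eq_measure_integral => A mA _; exact: m'E.
Qed.

Lemma integral_pullback (h : X' -> \bar R) : measurable_fun setT h ->
  (\int[m']_y h y = \int[m]_x h (Phi x))%E.
Proof.
move=> mh; rewrite integralE [RHS]integralE.
rewrite ge0_integral_pullback; last 2 first.
- exact: measurable_funepos.
- by move=> y; exact: funepos_ge0.
rewrite ge0_integral_pullback; last 2 first.
- exact: measurable_funeneg.
- by move=> y; exact: funeneg_ge0.
by congr (_ - _)%E; apply: eq_integral => x _; rewrite ?funeposE ?funenegE.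
Qed.

Lemma Lp_norm2_pullback g : Cmeasurable g ->
  Lp_norm m' 2%:E g = Lp_norm m 2%:E (g \o Phi).
Proof.
move=> mg; rewrite !Lp_norm2E; congr (poweR _ _); apply: ge0_integral_pullback.
  exact: measurable_sqnormc.
by move=> y; rewrite lee_fin sqr_ge0.
Qed.

Lemma Lp2_pullback g : Cmeasurable g -> (Lp m' 2%:E g <-> Lp m 2%:E (g \o Phi)).
Proof.
move=> mg; split=> -[_ h]; split => //.
- exact: Cmeasurable_pullback.
- by rewrite -Lp_norm2_pullback.
- by rewrite Lp_norm2_pullback.
Qed.

Lemma Cintegral_pullback g : Cmeasurable g ->
  Cintegral m' g = Cintegral m (g \o Phi).
Proof.
move=> mg; congr (_ +i* _); rewrite /Rintegral; congr fine;
  apply: (@integral_pullback (fun y => (_ (g y))%:E)); apply/measurable_EFinP.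
  exact: Cmeasurable_Re.
exact: Cmeasurable_Im.
Qed.

Lemma L2_dot_pullback g1 g2 : Cmeasurable g1 -> Cmeasurable g2 ->
  L2_dot m' g1 g2 = L2_dot m (g1 \o Phi) (g2 \o Phi).
Proof.
move=> m1 m2; rewrite /L2_dot Cintegral_pullback//.
apply: CmeasurableM => //.
exact: Cmeasurable_comp_continuous (@cconj_continuous R) m2.
Qed.

End pullback.

Lemma eq_ae_Cintegral d (X : measurableType d) (R : realType) (m : probability X R)
    (f g : X -> R[i]^o) : Cmeasurable f -> Cmeasurable g -> f = g %[ae m] ->
  Cintegral m f = Cintegral m g.
Proof.
move=> mf mg fg; congr (_ +i* _); rewrite /Rintegral; congr fine;
  apply: ae_eq_integral => //; try apply/measurable_EFinP;
  do ?[exact: Cmeasurable_Re|exact: Cmeasurable_Im];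
  by apply: filterS fg => x /[apply] ->.
Qed.

Lemma eq_ae_L2_dot d (X : measurableType d) (R : realType) (m : probability X R)
    (f f' g g' : X -> R[i]^o) :
  Cmeasurable f -> Cmeasurable f' -> Cmeasurable g -> Cmeasurable g' ->
  f = f' %[ae m] -> g = g' %[ae m] -> L2_dot m f g = L2_dot m f' g'.
Proof.
move=> mf mf' mg mg' ff gg; apply: eq_ae_Cintegral.
- apply: CmeasurableM => //.
  exact: Cmeasurable_comp_continuous (@cconj_continuous R) mg.
- apply: CmeasurableM => //.
  exact: Cmeasurable_comp_continuous (@cconj_continuous R) mg'.
- by apply: filterS2 ff gg => x h1 h2 _; rewrite h1// h2.
Qed.

(** * Closedness of the set of functions that factor through Phi *)

Section closure.
Context d d' (X : measurableType d) (X' : measurableType d') (R : realType).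
Variables (m : probability X R) (Phi : X -> X').
Hypothesis mPhi : measurable_fun [set: X] Phi.
Local Notation C := (R[i]^o).
Implicit Types (f : X -> C) (g : X' -> C).
Import ComplexField.Normc.

(** Convergence is known only at the points [Phi x]; the upper limit is defined and measurable on
    all of [X'], and [fine] sends its infinite values to 0. *)
Lemma factor_limit_real (f : X -> R) (g : nat -> X' -> R) :
  (forall k, measurable_fun setT (g k)) ->
  (\forall x \ae m, g ^~ (Phi x) @ \oo --> f x) ->
  exists2 h : X' -> R, measurable_fun setT h & \forall x \ae m, h (Phi x) = f x.
Proof.
move=> mg gf.
exists (fun y => fine (limn_esup (fun k => (g k y)%:E))).
  apply: measurableT_comp => //.
  by apply: measurable_fun_limn_esup => k; apply/measurable_EFinP.
apply: filterS gf => x gx.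
have gx' : (fun k => (g k (Phi x))%:E) @ \oo --> (f x)%:E.
  by apply/cvg_EFin => //; exact: nearW.
by rewrite is_cvg_limn_esupE ?(cvg_lim _ gx')//; apply/cvg_ex; exists (f x)%:E.
Qed.

(** The integrals of the squared errors are summable, so the series of squared errors is integrable,
    hence finite almost everywhere, and its terms tend to 0. *)
Lemma ae_cvg_of_L2 f (p : nat -> X -> C) : Cmeasurable f ->
  (forall k, Cmeasurable (p k)) ->
  (forall k, (\int[m]_x (normc ((f - p k)%R x) ^+ 2)%:E < ((2^-1 ^+ k) ^+ 2)%:E)%E) ->
  \forall x \ae m, (fun k => normc ((f - p k) x)) @ \oo --> (0 : R).
Proof.
move=> mf mp hp.
pose a k x := normc ((f - p k) x) ^+ 2.
have a0 k x : 0 <= a k x by exact: sqr_ge0.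
have ma k : measurable_fun setT (fun x => (a k x)%:E).
  apply: measurable_sqnormc; rewrite (_ : f - p k = (-1 : R[i]) *: p k + f).
    exact: Cmeasurable_lin.
  by rewrite scaleN1r addrC.
pose S x := (\sum_(k <oo) (a k x)%:E)%E.
have S0 x : (0 <= S x)%E by apply: nneseries_ge0 => k _ _; rewrite lee_fin.
have mS : measurable_fun setT S.
  by apply: ge0_emeasurable_sum => // k x _ _; rewrite lee_fin.
have iS : m.-integrable setT S.
  apply/integrableP; split => //.
  under eq_integral do rewrite gee0_abs//.
  rewrite integral_nneseries//; last by move=> k x _; rewrite lee_fin.
  apply: (@le_lt_trans _ _ (\sum_(k <oo | xpredT k) (2 / (2 ^ k.+1)%:R)%:E)%E).
    apply: lee_nneseries => k _.
      by move=> _; apply: integral_ge0 => x _; rewrite lee_fin.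
    have -> : 2 / (2 ^ k.+1)%:R = 2^-1 ^+ k :> R.
      by rewrite natrX exprS invfM mulrA divff ?pnatr_eq0// mul1r exprVn.
    have h0 : 0 <= 2^-1 :> R by rewrite invr_ge0.
    rewrite (le_trans (ltW (hp k)))// lee_fin expr2 ler_piMr ?exprn_ge0//.
    by rewrite exprn_ile1// invf_le1// ler1n.
  by apply: (le_lt_trans (@epsilon_trick0 _ _ _ _)) => //; rewrite ltry.
have := integrable_ae measurableT iS; apply: filterS => x /(_ I) Sx.
have := nnseries_is_cvg (a0 ^~ x); rewrite -/(S x) => /(_ _)/cvg_series_cvg_0.
rewrite -ge0_fin_numE// Sx => /(_ isT) /cvgrPdist_lt cv.
apply/cvgrPdist_lt => e e0; apply: filterS (cv _ (exprn_gt0 2 e0)) => k.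
rewrite !sub0r !normrN ger0_norm ?a0// ger0_norm ?normc_ge0// /a => h.
rewrite ltNge; apply/negP => h'; move: h; rewrite ltNge => /negP; apply.
by apply: lerXn2r => //; rewrite nnegrE ?normc_ge0// ltW.
Qed.

(** Any precision being available, the rate [2^-k] is imposed from the start and no subsequence is
    extracted. *)
Lemma factor_closed f : Cmeasurable f ->
  (forall e : R, 0 < e -> exists2 g : X' -> C, Cmeasurable g &
    (Lp_norm m 2%:E (f - (g \o Phi))%R < e%:E)%E) ->
  exists2 g : X' -> C, Cmeasurable g & g \o Phi = f %[ae m].
Proof.
move=> mf h.
have /choice[g hg] (k : nat) : exists g : X' -> C, Cmeasurable g /\
    (Lp_norm m 2%:E (f - (g \o Phi))%R < (2^-1 ^+ k)%:E)%E.
  by have [|g] := h (2^-1 ^+ k); [rewrite exprn_gt0// invr_gt0|exists g].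
have mp k : Cmeasurable (g k \o Phi).
  by apply: Cmeasurable_pullback => //; exact: (hg k).1.
have cv : \forall x \ae m, (fun k => normc ((f - (g k \o Phi)) x)) @ \oo --> (0 : R).
  apply: ae_cvg_of_L2 => // k; apply: Lp_norm2_lt; last exact: (hg k).2.
  by rewrite exprn_gt0// invr_gt0.
have [hR mhR hRE] : exists2 h : X' -> R, measurable_fun setT h &
    \forall x \ae m, h (Phi x) = complex.Re (f x).
  apply: (@factor_limit_real _ (fun k y => complex.Re (g k y))).
    by move=> k; apply: Cmeasurable_Re; exact: (hg k).1.
  apply: filterS cv => x /cvgrPdist_lt cv; apply/cvgrPdist_lt => e e0.
  apply: filterS (cv e e0) => k; rewrite sub0r normrN ger0_norm ?normc_ge0//.
  by apply: le_lt_trans; rewrite -ReB; exact: normr_Re_le.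
have [hI mhI hIE] : exists2 h : X' -> R, measurable_fun setT h &
    \forall x \ae m, h (Phi x) = complex.Im (f x).
  apply: (@factor_limit_real _ (fun k y => complex.Im (g k y))).
    by move=> k; apply: Cmeasurable_Im; exact: (hg k).1.
  apply: filterS cv => x /cvgrPdist_lt cv; apply/cvgrPdist_lt => e e0.
  apply: filterS (cv e e0) => k; rewrite sub0r normrN ger0_norm ?normc_ge0//.
  by apply: le_lt_trans; rewrite -ImB; exact: normr_Im_le.
exists (fun y => hR y +i* hI y); first exact: CmeasurableP.
by apply: filterS2 hRE hIE => x hx hx' _ /=; rewrite hx hx'; case: (f x).
Qed.

End closure.

Section factor_unitary.
Context d d' (X : measurableType d) (X' : measurableType d') (R : realType).
Variables (m : probability X R) (m' : probability X' R) (Phi : X -> X').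
Hypothesis mPhi : measurable_fun [set: X] Phi.
Hypothesis m'E : forall A, measurable A -> m' A = m (Phi @^-1` A).
Local Notation C := (R[i]^o).

Definition L2_lift (U : (X -> C) -> (X' -> C)) := forall f, Lp m 2%:E f ->
  Lp m' 2%:E (U f) /\ U f \o Phi = f %[ae m].

Lemma L2_lift_exists :
  (forall f, Lp m 2%:E f -> exists2 g : X' -> C, Cmeasurable g & g \o Phi = f %[ae m]) ->
  exists U, L2_lift U.
Proof.
move=> h; have /choice[U HU] (f : X -> C) : exists g : X' -> C, Lp m 2%:E f ->
    Lp m' 2%:E g /\ g \o Phi = f %[ae m].
  have [Lf|nLf] := pselect (Lp m 2%:E f); last by exists 0.
  have [g mg gf] := h f Lf; exists g => _; split => //.
  apply/(Lp2_pullback mPhi m'E mg); apply: (eq_ae_Lp2 _ _ Lf).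
    exact: Cmeasurable_pullback.
  exact: ae_eq_sym.
by exists U.
Qed.

Variable U : (X -> C) -> (X' -> C).
Hypothesis HU : L2_lift U.

Lemma L2_lift_measurable f : Lp m 2%:E f -> Cmeasurable (U f).
Proof. by move=> /HU[[]]. Qed.

(** Composition with [Phi] is injective modulo null sets, so identities for [U] can be checked on
    [X]; the properties of [U] below reduce to this. *)
Lemma L2_lift_ae_eq f g : Lp m 2%:E f -> Cmeasurable g -> f = g \o Phi %[ae m] ->
  U f = g %[ae m'].
Proof.
move=> Lf mg fg; apply: (ae_eq_pushforward mPhi m'E) => //.
  exact: L2_lift_measurable.
by apply: ae_eq_trans fg; exact: (HU Lf).2.
Qed.

Lemma L2_lift_isometry : L2_isometry m m' U.
Proof.
split=> [f /HU[]//|f g Lf Lg fg|a f g Lf Lg|f g Lf Lg].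
- apply: L2_lift_ae_eq => //; first exact: L2_lift_measurable.
  by apply: (ae_eq_trans fg); apply: ae_eq_sym; exact: (HU Lg).2.
- apply: L2_lift_ae_eq; first exact: Lp2_lin.
    by apply: Cmeasurable_lin; exact: L2_lift_measurable.
  apply: filterS2 (HU Lf).2 (HU Lg).2 => x /(_ I) h1 /(_ I) h2 _.
  rewrite -[RHS]/(a *: (U f \o Phi) x + (U g \o Phi) x).
  by rewrite h1 h2.
- have mf := L2_lift_measurable Lf; have mg := L2_lift_measurable Lg.
  rewrite (L2_dot_pullback mPhi m'E)//.
  apply: eq_ae_L2_dot; [exact: Cmeasurable_pullback|by case: Lf
    |exact: Cmeasurable_pullback|by case: Lg|exact: (HU Lf).2|exact: (HU Lg).2].
Qed.

Lemma pullback_isometry : L2_isometry m' m (fun g => g \o Phi).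
Proof.
split=> [g Lg|f g _ _ fg|a f g Lf Lg|f g [mf _] [mg _]].
- by apply/(Lp2_pullback mPhi m'E) => //; case: Lg.
- exact: (ae_eq_pullback mPhi m'E).
- exact: aeW.
- by rewrite -(L2_dot_pullback mPhi m'E).
Qed.

Lemma L2_lift_unitary : L2_unitary m m' U (fun g => g \o Phi).
Proof.
split=> [||f /HU[]//|g Lg]; [exact: L2_lift_isometry|exact: pullback_isometry|].
case: (Lg) => mg _; apply: L2_lift_ae_eq => //.
  exact/(Lp2_pullback mPhi m'E).
exact: aeW.
Qed.

Lemma L2_lift_multiplicative : multiplicative_on_Linf m m' U.
Proof.
move=> f g Lf Lg; apply: L2_lift_ae_eq; first exact: Linf_mul_Lp2.
  by apply: CmeasurableM; apply: L2_lift_measurable; exact: Linf_Lp2.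
have [_ hf] := HU (Linf_Lp2 Lf); have [_ hg] := HU (Linf_Lp2 Lg).
by apply: filterS2 hf hg => x /(_ I) /= h1 /(_ I) /= h2 _; rewrite h1 h2.
Qed.

Lemma pullback_multiplicative : multiplicative_on_Linf m' m (fun g : X' -> C => g \o Phi).
Proof. by move=> f g _ _; exact: aeW. Qed.

End factor_unitary.

(** * The random measure of a positive process *)

Lemma ae_forall_countable d (X : measurableType d) (R : realType)
    (m : {measure set X -> \bar R}) (J : countType) (P : J -> X -> Prop) :
  (forall j, \forall x \ae m, P j x) -> \forall x \ae m, forall j, P j x.
Proof.
move=> h.
have : \forall x \ae m, forall k : nat, if unpickle k is Some j then P j x else True.
  by apply: ae_foralln => k; case: unpickle => [j|]; [exact: h|exact: aeW].
by apply: filterS => x h' j; have := h' (pickle j); rewrite pickleK.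
Qed.

Lemma eq_ae_measure d (X : measurableType d) (R : realType)
    (m : {measure set X -> \bar R}) (A B : set X) : measurable A -> measurable B ->
  (\forall x \ae m, A x <-> B x) -> m A = m B.
Proof.
suff le (A' B' : set X) : measurable A' -> measurable B' ->
    (\forall x \ae m, A' x <-> B' x) -> (m A' <= m B')%E.
  move=> mA mB AB; apply/eqP; rewrite eq_le !le//.
  by apply: filterS AB => x; tauto.
move=> mA mB [Z [mZ Z0 hZ]].
apply: (@le_trans _ _ (m (B' `|` Z))).
  apply: le_measure; rewrite ?inE//; first exact: measurableU.
  move=> x Ax; have [Bx|nBx] := pselect (B' x); [by left|right].
  by apply: hZ => /= -[/(_ Ax)].
by rewrite (le_trans (measureU2 _ _ _))// [X in (_ + X <= _)%E]Z0 adde0.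
Qed.

(** In the topological case the open sets generate the sigma-algebra, so continuity of [alpha t] is
    enough. *)
Lemma dynamical_system_measurable (G : topologicalZmodType) d (X : measurableType d)
    (alpha : G -> X -> X) : dynamical_system alpha ->
  forall t, measurable_fun [set: X] (alpha t).
Proof.
move=> [[_ [cX [_ _ mE ca]]] t|[]//].
set Y := Topological.Pack cX in mE ca.
apply: (@measurability _ _ _ X _ _ (@open Y) mE) => _ [V oV <-].
rewrite setTI mE; apply: sub_gen_smallest.
have ct : continuous (fun y : Y => alpha t y : Y).
  move=> y; apply: (@continuous_comp Y (G * Y)%type Y (fun y => (t, y))
    (fun p => alpha p.1 p.2)); last exact: ca.
  by apply: cvg_pair; [exact: cvg_cst|exact: cvg_id].
by move/continuousP : ct; apply.
Qed.

Section random_measure.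
Variables (R : realType) (G : topologicalZmodType) (J : countType) (e : J -> G -> R).
Hypothesis He : approximating e.
Context d (Omega : measurableType d) (m : probability Omega R).
Local Notation C := (R[i]^o).
Variable N : Cc G R -> Omega -> C.
Hypothesis N_Cmeasurable : forall phi, Cmeasurable (N phi).
Hypothesis N_linear : forall (a : R[i]) phi psi,
    N (a *: phi + psi) = a *: N phi + N psi %[ae m].
Hypothesis N_ge0 : forall phi : Cc G R, (forall x, 0 <= phi x) ->
      {ae m, forall w, 0 <= N phi w}.
Local Notation E s := (lincomb (e : _ -> (G -> R^o)) s).
Import ComplexField.Normc.

Lemma process0 : \forall w \ae m, N 0 w = 0.
Proof.
have := N_linear (-1) 0 0; rewrite scaler0 addr0; apply: filterS => w /(_ I) ->.
by rewrite -[LHS]/(-1 *: N 0 w + N 0 w) scaleN1r addNr.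
Qed.

Lemma processD phi psi : \forall w \ae m, N (phi + psi) w = N phi w + N psi w.
Proof.
have := N_linear 1 phi psi; rewrite scale1r; apply: filterS => w /(_ I) ->.
by rewrite -[LHS]/(1 *: N phi w + N psi w) scale1r.
Qed.

Lemma processZ (a : R[i]) phi : \forall w \ae m, N (a *: phi) w = a * N phi w.
Proof.
have := N_linear a phi 0; rewrite addr0; apply: filterS2 process0 => w h0 /(_ I) ->.
by rewrite -[LHS]/(a *: N phi w + N 0 w) h0 addr0.
Qed.

Lemma processB phi psi : \forall w \ae m, N (phi - psi) w = N phi w - N psi w.
Proof.
have := processZ (-1) psi; rewrite scaleN1r.
apply: filterS2 (processD phi (- psi)) => w -> ->.
by rewrite mulN1r.
Qed.

Definition process_value (w : Omega) (i : J) : R := complex.Re (N (family_Cc He i) w).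
Local Notation L w s := (lincomb (process_value w : _ -> R^o) s).

Lemma process_lincomb s : \forall w \ae m, N (lincomb_Cc He s) w = (L w s)%:C.
Proof.
rewrite /lincomb_Cc; elim: s => [|p s IH].
  rewrite big_nil; apply: filterS process0 => w ->.
  by rewrite /lincomb big_nil.
rewrite big_cons.
have fam0 : \forall w \ae m, N (family_Cc He p.2) w = (process_value w p.2)%:C.
  apply: (filterS _ (N_ge0 (phi := family_Cc He p.2) _)) => [w h|x].
    by rewrite RRe_real// ger0_real.
  by rewrite -[X in 0 <= X]/((e p.2 x)%:C) ler0c; exact: approximating_ge0.
have lin := N_linear p.1%:C (family_Cc He p.2)
  (\sum_(p <- s) p.1%:C *: family_Cc He p.2).
apply: filterS3 IH fam0 lin => w h1 h2 /(_ I) ->.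
rewrite -[LHS]/(p.1%:C * N _ w + N _ w) h1 h2.
by rewrite /lincomb big_cons rmorphD/= -rmorphM.
Qed.

Definition positive_values (w : Omega) :=
  forall s, (forall x, 0 <= E s x) -> 0 <= L w s.

Lemma ae_positive_values : \forall w \ae m, positive_values w.
Proof.
have : \forall w \ae m, forall s : seq (rat * J),
    (forall x, 0 <= E [seq (ratr p.1, p.2) | p <- s] x) ->
    0 <= L w [seq (ratr p.1, p.2) | p <- s].
  apply: ae_forall_countable => s.
  have [s0|ns] := pselect (forall x, 0 <= E [seq (ratr p.1, p.2) | p <- s] x); last first.
    by apply: aeW => w /ns.
  have := process_lincomb [seq (ratr p.1, p.2) | p <- s].
  apply: filterS2 (N_ge0 (phi := lincomb_Cc He [seq (ratr p.1, p.2) | p <- s]) _).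
    by move=> w h1 h2 _; rewrite -ler0c -h2.
  by move=> x; rewrite lincomb_CcE ler0c.
by apply: filterS => w; exact: rational_positivity.
Qed.

Lemma random_measure_exists : exists Phi : Omega -> pmeasure G R,
  measurable_fun [set: Omega] Phi /\
  \forall w \ae m, family_value He (Phi w) = process_value w.
Proof.
have [Z [mZ Z0 hZ]] := ae_positive_values.
have /choice[Phi hPhi] (w : Omega) : exists nu : pmeasure G R,
    (w \notin Z -> family_value He nu = process_value w) /\
    (w \in Z -> forall i, family_value He nu i = 0).
  have [wZ|wZ] := boolP (w \in Z).
    by exists (exist _ (point : cmeasure G R) (mem_set (@positive0 G R))); split.
  have pw : positive_values w by apply: contrapT => /hZ/mem_set; apply/negP.
  have [nu hnu] := pmeasure_exists He pw.
  by exists nu.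
exists Phi; split.
  apply: (measurable_fun_pmeasure (He := He)) => i.
  rewrite (_ : (fun w => _) = (fun w => \1_(~` Z) w * process_value w i)).
    apply: measurable_funM; first by apply: measurable_indic; exact: measurableC.
    exact: Cmeasurable_Re.
  apply/funext => w; rewrite indicE in_setC; have [wZ|wZ] := boolP (w \in Z).
    by rewrite (hPhi w).2// mul0r.
  by rewrite (hPhi w).1// mul1r.
exists Z; split => // w /= nw; apply: contrapT => wZ; apply: nw.
by apply: (hPhi w).1; apply/negP => /set_mem.
Qed.

Variable Phi : Omega -> pmeasure G R.
Hypothesis PhiE : \forall w \ae m, family_value He (Phi w) = process_value w.

(** [f] is enclosed between [E (s k)] plus and minus [E s0 / (k + 1)]. Positivity of [N] on these
    countably many differences costs one null set; off it both sides lie within [L w s0 / (k + 1)]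
    of [L w (s k)] for every [k]. *)
Lemma process_real_eval f (rf : real_Cc f) :
  \forall w \ae m, N (Cc_real rf) w = pmeasure_eval (Cc_real rf) (Phi w).
Proof.
have [cf sf] := rf; have [s0 s00 hs0] := approximating_dense He cf sf.
have /choice[s hs] (k : nat) : exists s, forall x, `|f x - E s x| <= k.+1%:R^-1 * E s0 x.
  by apply: hs0; rewrite invr_gt0.
have hN : \forall w \ae m, forall k,
    N (Cc_real rf) w <= (L w (s k ++ scale_seq (k.+1%:R^-1) s0))%:C /\
    (L w (s k ++ scale_seq (- k.+1%:R^-1) s0))%:C <= N (Cc_real rf) w.
  apply: ae_foralln => k.
  set t := s k ++ _; set t' := s k ++ _.
  have p1 : \forall w \ae m, 0 <= N (lincomb_Cc He t - Cc_real rf) w.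
    apply: N_ge0 => x.
    rewrite -[X in _ <= X]/(lincomb_Cc He t x - (f x)%:C) lincomb_CcE -rmorphB/= ler0c.
    rewrite subr_ge0 lincomb_fun_cat lincomb_fun_scale.
    by have := hs k x; rewrite ler_distl => /andP[].
  have p2 : \forall w \ae m, 0 <= N (Cc_real rf - lincomb_Cc He t') w.
    apply: N_ge0 => x.
    rewrite -[X in _ <= X]/((f x)%:C - lincomb_Cc He t' x) lincomb_CcE -rmorphB/= ler0c.
    rewrite subr_ge0 lincomb_fun_cat lincomb_fun_scale mulNr.
    by have := hs k x; rewrite ler_distl => /andP[].
  have q1 := processB (lincomb_Cc He t) (Cc_real rf).
  have q2 := processB (Cc_real rf) (lincomb_Cc He t').
  have r1 := process_lincomb t; have r2 := process_lincomb t'.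
  near=> w; split; rewrite -subr_ge0.
    have <- : N (lincomb_Cc He t) w = (L w t)%:C by near: w.
    have <- : N (lincomb_Cc He t - Cc_real rf) w =
        N (lincomb_Cc He t) w - N (Cc_real rf) w.
      by near: w.
    by near: w.
  have <- : N (lincomb_Cc He t') w = (L w t')%:C by near: w.
  have <- : N (Cc_real rf - lincomb_Cc He t') w =
      N (Cc_real rf) w - N (lincomb_Cc He t') w.
    by near: w.
  by near: w.
apply: filterS3 hN PhiE ae_positive_values => w hN hPhi pw.
have L0 : 0 <= (L w s0 : R) by exact: pw.
rewrite (pmeasure_eval_real He).
set b := complex.Re (pmeasure_eval _ _).
pose l0 : R := L w s0; pose l k : R := L w (s k).
have hb k : `|b - l k| <= k.+1%:R^-1 * l0.
  have := dominated_value_dist (pmeasure_eval_dominated He (Phi w) rf) (hs k).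
  by rewrite hPhi.
set a := N (Cc_real rf) w in hN *.
have aE : a = (complex.Re a)%:C.
  have [+ _] := hN 0%N; rewrite lecE /= => /andP[/eqP h _].
  by rewrite [LHS]complexE_pair -h.
have ha k : `|complex.Re a - l k| <= k.+1%:R^-1 * l0.
  have [] := hN k; rewrite !lecE /= => /andP[_ h1] /andP[_ h2].
  rewrite ler_distl; move: h1 h2.
  by rewrite !lincomb_values_cat !lincomb_values_scale mulNr => -> ->.
rewrite aE; congr (_%:C); apply/eqP; rewrite eq_le; apply/andP; split;
  apply: (@ler_addgt0M _ _ _ (2 * l0)) => eps eps0;
  have [k _ /(_ k (leqnn _)) /= hk] := near_infty_natSinv_lt (PosNum eps0);
  have hk' : k.+1%:R^-1 * l0 <= eps * l0 by rewrite ler_wpM2r// ltW.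
- by move: (ha k) (hb k) hk'; move: (k.+1%:R^-1) => K;
    rewrite !ler_distl => /andP[? ?] /andP[? ?] ?; lra.
- by move: (ha k) (hb k) hk'; move: (k.+1%:R^-1) => K;
    rewrite !ler_distl => /andP[? ?] /andP[? ?] ?; lra.
Unshelve. all: by end_near. Qed.

Lemma process_eval phi : pmeasure_eval phi \o Phi = N phi %[ae m].
Proof.
have h1 := process_real_eval (real_Cc_Re phi).
have h2 := process_real_eval (real_Cc_Im phi).
have h3 := N_linear 'i%C (Cc_real (real_Cc_Im phi)) (Cc_real (real_Cc_Re phi)).
rewrite -(Cc_ReIm phi) in h3.
apply: filterS3 h1 h2 h3 => w h1 h2 /(_ I) h3 _.
rewrite h3 -[RHS]/('i%C * N _ w + N _ w) h1 h2 /= {1}(Cc_ReIm phi).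
by rewrite pmeasure_evalD pmeasure_evalZ.
Qed.

End random_measure.

(** * The translation action on positive measures *)

Section pmeasure_dynamics.
Variables (G : topologicalZmodType) (R : realType).
Local Notation C := (R[i]^o).
Implicit Type nu : pmeasure G R.

Lemma pmeasure_inj nu nu' : (forall phi, pmeasure_eval phi nu = pmeasure_eval phi nu') ->
  nu = nu'.
Proof. by move=> h; apply/val_inj/val_inj/funext => phi; exact: h. Qed.

Lemma pmeasure_eval_act t phi nu :
  pmeasure_eval phi (pmeasure_act t nu) = pmeasure_eval (Cc_translate (- t) phi) nu.
Proof. by []. Qed.

Lemma pmeasure_group_action : group_action (@pmeasure_act G R).
Proof.
split=> [nu|s t nu]; apply: pmeasure_inj => phi; rewrite !pmeasure_eval_act.
  congr pmeasure_eval; apply/val_inj/funext => x /=.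
  by rewrite oppr0 subr0.
congr pmeasure_eval; apply/val_inj/funext => x /=.
by rewrite !opprK addrA addrAC.
Qed.

(** Orbit maps are vaguely continuous by [translate_continuous], hence Borel, which is measurability
    in the group variable. *)
Lemma pmeasure_dynamical_system : locally_compact [set: G] ->
  dynamical_system (@pmeasure_act G R).
Proof.
move=> lG; right; split; first exact: pmeasure_group_action.
  exact: pmeasure_act_measurable.
move=> nu _ [B mB <-]; rewrite setTI.
have ca : continuous (fun t : G => cmeasure_act t (set_val (nu : pmeasure_set G R))).
  move=> t; apply: (cmeasure_cvg (fmap_filter _ (nbhs_filter t))) => phi.
  have [_ cnu] := cmeasureP (set_val (nu : pmeasure_set G R)).
  apply: (@continuous_comp G (Cc G R) C (fun t => Cc_translate (- t) phi));
    last exact: cnu.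
  apply: (@continuous_comp G G (Cc G R) -%R (fun t => Cc_translate t phi)).
    exact: (@tvs.opp_continuous G).
  exact: translate_continuous.
pose act t := cmeasure_act t (set_val (nu : pmeasure_set G R)).
have sG := sigma_algebra_image act (smallest_sigma_algebra [set: G] open).
rewrite -[X in <<s _ >> X]setTI; apply: (smallest_sub sG _ mB).
move=> V oV; rewrite /image_set_system /= setTI; apply: sub_gen_smallest.
by move/continuousP : ca; apply.
Qed.

(** Positivity makes the values on real functions real, so conjugation only changes the sign of the
    part that comes from [Im phi]. *)
Lemma pmeasure_eval_conj (I : eqType) (e : I -> G -> R) : approximating e ->
  forall phi nu, cconj (pmeasure_eval phi nu) = pmeasure_eval (Cc_conj phi) nu.
Proof.
move=> He phi nu.
have -> : Cc_conj phi =
    (- 'i%C) *: Cc_real (real_Cc_Im phi) + Cc_real (real_Cc_Re phi).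
  apply/val_inj/funext => x /=.
  rewrite -[RHS]/(- 'i%C * (complex.Im (phi x))%:C + (complex.Re (phi x))%:C).
  by rewrite /cconj; case: (phi x) => a b; simpc.
rewrite pmeasure_evalD pmeasure_evalZ {1}(Cc_ReIm phi) pmeasure_evalD pmeasure_evalZ.
rewrite (pmeasure_eval_real He nu (real_Cc_Im phi)).
rewrite (pmeasure_eval_real He nu (real_Cc_Re phi)).
by rewrite /cconj; simpc.
Qed.

End pmeasure_dynamics.

(** * The law of the random measure and the equivalence of the processes *)

Section process_of_random_measure.
Variables (R : realType) (G : topologicalZmodType) (J : countType) (e : J -> G -> R).
Hypothesis He : approximating e.
Hypothesis lG : locally_compact [set: G].
Context d (Omega : measurableType d) (alpha : G -> Omega -> Omega)
  (m : probability Omega R) (N : Cc G R -> Omega -> R[i]^o).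
Hypothesis N_process : spatial_process alpha m N.
Variables (Phi : Omega -> pmeasure G R) (m' : probability (pmeasure G R) R).
Hypothesis mPhi : measurable_fun [set: Omega] Phi.
Hypothesis m'E : forall A, measurable A -> m' A = m (Phi @^-1` A).
Hypothesis PhiE : forall phi, pmeasure_eval phi \o Phi = N phi %[ae m].
Local Notation C := (R[i]^o).
Import ComplexField.Normc.

Lemma process_Cmeasurable phi : Cmeasurable (N phi).
Proof. by have [] := sp_L2 N_process phi. Qed.

Lemma alpha_measurable t : measurable_fun [set: Omega] (alpha t).
Proof. exact: dynamical_system_measurable (sp_ds N_process) t. Qed.

Lemma ae_alpha (P : set Omega) t : (\forall w \ae m, P w) ->
  \forall w \ae m, P (alpha t w).
Proof.
apply: (@ae_pullback _ _ _ _ _ m m (alpha t) (alpha_measurable t)) => A mA.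
by rewrite (sp_invariant N_process).
Qed.

(** For each [phi] the equivariance of [N] gives the equality of values off a null set depending on
    [phi]; the countable family determines the measure, so for fixed [t] one null set suffices. *)
Lemma random_measure_equivariant t :
  \forall w \ae m, Phi (alpha t w) = pmeasure_act t (Phi w).
Proof.
have : \forall w \ae m, forall j,
    family_value He (Phi (alpha t w)) j = family_value He (pmeasure_act t (Phi w)) j.
  apply: ae_forall_countable => j.
  have h1 := ae_alpha t (PhiE (family_Cc He j)).
  have h2 := sp_equivariant N_process (- t) (family_Cc He j).
  have h3 := PhiE (Cc_translate (- t) (family_Cc He j)).
  apply: filterS3 h1 h2 h3 => w /(_ I) h1 /(_ I) h2 /(_ I) h3.
  rewrite /family_value; congr complex.Re.
  rewrite -[LHS]/((pmeasure_eval (family_Cc He j) \o Phi) (alpha t w)) h1.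
  rewrite pmeasure_eval_act -[RHS]/((pmeasure_eval _ \o Phi) w) h3 -h2.
  by rewrite /koopman opprK.
by apply: filterS => w h; exact: (pmeasure_ext h).
Qed.

Lemma pmeasure_eval_Lp2 phi : Lp m' 2%:E (@pmeasure_eval G R phi).
Proof.
apply/(Lp2_pullback mPhi m'E); first exact: pmeasure_eval_measurable.
apply: (eq_ae_Lp2 _ _ (sp_L2 N_process phi)).
  by apply: Cmeasurable_pullback => //; exact: pmeasure_eval_measurable.
exact: (ae_eq_sym (PhiE phi)).
Qed.

Lemma pmeasure_invariant : invariant_measure (@pmeasure_act G R) m'.
Proof.
move=> t A mA.
have mact : measurable (@pmeasure_act G R t @^-1` A).
  by rewrite -[X in measurable X]setTI; exact: pmeasure_act_measurable.
have mPA : measurable (Phi @^-1` A) by rewrite -[X in measurable X]setTI; exact: mPhi.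
rewrite !m'E// -(sp_invariant N_process t mPA); apply: eq_ae_measure.
- by rewrite -[X in measurable X]setTI; exact: mPhi.
- by rewrite -[X in measurable X]setTI; exact: alpha_measurable.
- by apply: filterS (random_measure_equivariant t) => w /= ->.
Qed.

Lemma pmeasure_is_PMDS : is_PMDS m'.
Proof.
by split=> [|phi]; [exact: pmeasure_invariant|have /Lp2P[] := pmeasure_eval_Lp2 phi].
Qed.

(** Linearity, conjugation and equivariance hold at every measure. Continuity is inherited from [N],
    since composition with [Phi] preserves the L^2 norm and turns evaluations into [N]. *)
Lemma pmeasure_spatial_process :
  spatial_process (@pmeasure_act G R) m' (@pmeasure_eval G R).
Proof.
split.
- exact: pmeasure_dynamical_system.
- exact: pmeasure_invariant.
- exact: pmeasure_eval_Lp2.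
- by move=> a phi psi; apply: aeW => nu _; exact: pmeasure_eval_linear.
- move=> phi eps eps0; apply: filterS (sp_continuous N_process phi eps0) => psi.
  have mB (V : Type) (f g : V -> C) : f - g = (-1 : R[i]) *: g + f.
    by rewrite scaleN1r addrC.
  rewrite (Lp_norm2_pullback mPhi m'E); last first.
    by rewrite mB; apply: Cmeasurable_lin; exact: pmeasure_eval_measurable.
  apply: le_lt_trans; rewrite (@eq_ae_Lp_norm2 _ _ _ _ _ (N psi - N phi))//.
  + apply: (Cmeasurable_pullback mPhi
      (g := @pmeasure_eval G R psi - @pmeasure_eval G R phi)).
    by rewrite mB; apply: Cmeasurable_lin; exact: pmeasure_eval_measurable.
  + by rewrite mB; apply: Cmeasurable_lin; exact: process_Cmeasurable.
  + apply: filterS2 (PhiE psi) (PhiE phi) => w /(_ I) h1 /(_ I) h2 _.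
    rewrite -[LHS]/((pmeasure_eval psi \o Phi) w - (pmeasure_eval phi \o Phi) w).
    by rewrite h1 h2.
- by move=> phi; apply: aeW => nu _; exact: (pmeasure_eval_conj He).
- move=> t phi; apply: aeW => nu _.
  by rewrite /koopman pmeasure_eval_act opprK.
Qed.

Lemma Cc_product_factor (p : Omega -> C) : Cc_product N p ->
  Cmeasurable p /\ exists2 g : pmeasure G R -> C, Cmeasurable g & g \o Phi = p %[ae m].
Proof.
move=> [n [theta [phi ->]]].
have mtheta j : continuous (theta j) by have /Cc_predP[] := Cc_funP (theta j).
have mprod d0 (Y : measurableType d0) (F : 'I_n.+1 -> Y -> C) (s : seq 'I_n.+1) :
    (forall j, Cmeasurable (F j)) -> Cmeasurable (fun y => \prod_(j <- s) (F j y : R[i])).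
  move=> mF; elim: s => [|j s IH].
    rewrite (_ : (fun y => _) = cst 1); first exact: Cmeasurable_cst.
    by apply/funext => y; rewrite big_nil.
  rewrite (_ : (fun y => _) = (fun y => F j y * \prod_(i <- s) (F i y : R[i]) : R[i])).
    exact: CmeasurableM.
  by apply/funext => y; rewrite big_cons.
split.
  apply: mprod => j; apply: Cmeasurable_comp_continuous => //.
  exact: process_Cmeasurable.
exists (fun nu => \prod_(j < n.+1) (theta j (pmeasure_eval (phi j) nu) : R[i])).
  apply: mprod => j; apply: Cmeasurable_comp_continuous => //.
  exact: pmeasure_eval_measurable.
have := ae_forall_countable (fun j => PhiE (phi j)).
apply: filterS => w hw _ /=; apply: eq_bigr => j _.
by rewrite -[pmeasure_eval _ _]/((pmeasure_eval (phi j) \o Phi) w) hw.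
Qed.

Hypothesis N_full : full_process m N.

(** Fullness enters here: combinations of the products are of the form [g \o Phi] up to null sets,
    so every square integrable [f] is a limit of such functions. *)
Lemma full_factor f : Lp m 2%:E f ->
  exists2 g : pmeasure G R -> C, Cmeasurable g & g \o Phi = f %[ae m].
Proof.
move=> Lf; apply: (factor_closed mPhi); first by case: Lf.
move=> eps eps0; have [k [c [p [hp hlt]]]] := N_full Lf eps0.
have /choice[g hg] (i : 'I_k) : exists g : pmeasure G R -> C,
    Cmeasurable g /\ g \o Phi = p i %[ae m].
  by have [_ [g mg gE]] := Cc_product_factor (hp i); exists g.
have msum d0 (Y : measurableType d0) (F : 'I_k -> Y -> C) (s : seq 'I_k) :
    (forall i, Cmeasurable (F i)) -> Cmeasurable (\sum_(i <- s) c i *: F i).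
  move=> mF; elim: s => [|i s IH]; first by rewrite big_nil; exact: Cmeasurable_cst.
  by rewrite big_cons; exact: Cmeasurable_lin.
have mg : Cmeasurable (\sum_(i < k) c i *: g i) by apply: msum => i; exact: (hg i).1.
exists (\sum_(i < k) c i *: g i) => //.
have mB (f1 f2 : Omega -> C) : Cmeasurable f1 -> Cmeasurable f2 -> Cmeasurable (f1 - f2).
  by move=> m1 m2; rewrite addrC -scaleN1r; exact: Cmeasurable_lin.
rewrite (@eq_ae_Lp_norm2 _ _ _ _ _ (f - \sum_(i < k) c i *: p i))//.
- by apply: mB; [case: Lf|exact: Cmeasurable_pullback].
- by apply: mB; [case: Lf|apply: msum => i; exact: (Cc_product_factor (hp i)).1].
- have := ae_forall_countable (fun i => (hg i).2).
  apply: filterS => w hw _.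
  rewrite -[LHS]/(f w - (\sum_(i < k) c i *: g i) (Phi w)).
  rewrite -[RHS]/(f w - (\sum_(i < k) c i *: p i) w).
  rewrite !fct_sumE; congr (_ - _); apply: eq_bigr => i _.
  by rewrite -[LHS]/(c i *: (g i \o Phi) w) hw.
Qed.

Lemma full_process_equivalent :
  equivalent_processes alpha m N (@pmeasure_act G R) m' (@pmeasure_eval G R).
Proof.
have [U HU] := L2_lift_exists mPhi m'E full_factor.
exists U, (fun g => g \o Phi); split.
- exact: (L2_lift_unitary mPhi m'E HU).
- move=> phi; apply: (L2_lift_ae_eq mPhi m'E HU).
  + exact: sp_L2 N_process phi.
  + exact: pmeasure_eval_measurable.
  + exact: (ae_eq_sym (PhiE phi)).
- move=> t f Lf; apply: (L2_lift_ae_eq mPhi m'E HU).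
  + have inv A : measurable A -> m A = m (alpha (- t) @^-1` A).
      by move=> mA; rewrite (sp_invariant N_process).
    have mf : Cmeasurable f by case: Lf.
    exact: (iffLR (Lp2_pullback (alpha_measurable (- t)) inv mf) Lf).
  + apply: (Cmeasurable_pullback (pmeasure_act_measurable (- t))).
    exact: (L2_lift_measurable HU).
  (* At almost every [w], [U f] at [pmeasure_act (- t) (Phi w) = Phi (alpha (- t) w)] equals
     [f (alpha (- t) w)]. *)
  + have h1 := ae_alpha (- t) (HU f Lf).2.
    apply: filterS2 h1 (random_measure_equivariant (- t)) => w /(_ I) h1 h2 _.
    by rewrite /koopman /= -h2.
- exact: (L2_lift_multiplicative mPhi m'E HU).
- exact: pullback_multiplicative.
Qed.

End process_of_random_measure.

Theorem theorem4p1 (R : realType) (G : topologicalZmodType)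
    (G_hausdorff : hausdorff_space G)
    (G_locally_compact : locally_compact [set: G])
    (G_second_countable : @second_countable G)
    (d : measure_display) (Omega : measurableType d)
    (alpha : G -> Omega -> Omega) (m : probability Omega R)
    (N : Cc G R -> Omega -> R[i]^o)
    (N_process : spatial_process alpha m N)
    (N_full : full_process m N)
    (N_ge0 : forall phi : Cc G R, (forall x, 0 <= phi x) ->
      {ae m, forall w, 0 <= N phi w}) :
  exists m' : probability (pmeasure G R) R,
    [/\ is_PMDS m',
      spatial_process (@pmeasure_act G R) m' (@pmeasure_eval G R) &
      equivalent_processes alpha m N
        (@pmeasure_act G R) m' (@pmeasure_eval G R)].
Proof.
have [e He] := @countable_approximating R G
  G_hausdorff G_locally_compact G_second_countable.
have mN phi : Cmeasurable (N phi) := process_Cmeasurable N_process phi.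
have lN := sp_linear N_process.
have [Phi [mPhi PhiV]] := random_measure_exists He mN lN N_ge0.
have PhiE := process_eval lN N_ge0 PhiV.
pose X : {mfun Omega >-> pmeasure G R} :=
  HB.pack Phi (isMeasurableFun.Build _ _ _ _ _ mPhi).
pose m' : probability (pmeasure G R) R := distribution m X.
have m'E A : measurable A -> m' A = m (Phi @^-1` A) by [].
exists m'; split.
- exact: (pmeasure_is_PMDS He N_process mPhi m'E PhiE).
- exact: (pmeasure_spatial_process He G_locally_compact N_process mPhi m'E PhiE).
- exact: (full_process_equivalent He N_process mPhi m'E PhiE N_full).
Qed.
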